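(* Let $d>0$ be a fixed integer. As $b\to\infty$ through the integers $b>d$, the quantity $I(b,d,1)-b\log(b)$ has an asymptotic expansion to all orders in inverse powers of $b$. The start of this expansion is $$I(b,d,1)=b\log(b)+\frac{a_1(d)}{b}+\frac{a_2(d)}{b^2}+\frac{a_3(d)}{b^3}+\frac{a_4(d)}{b^4}+\frac{a_5(d)}{b^5}+O(b^{-6}),$$ with (implicit constant depending on $d$): \begin{align*} a_1(d)={}&(d+\tfrac12)d^{-2},\\ a_2(d)={}&-\frac{9d^2+8d+2}{6d^3(d+1)},\\ a_3(d)={}&(d+\tfrac12)\zeta(2)+(d+\tfrac12)\frac{2d^3+4d^2+4d+1}{2d^4(d+1)^2},\\ a_4(d)={}&-(2d+1)d\,\zeta(3)+(d+\tfrac12)\zeta(2)\\ &-\frac{60d^7+180d^6+350d^5+585d^4+597d^3+331d^2+96d+12}{60d^5(d+1)^3},\\ a_5(d)={}&3(d+\tfrac12)d^2\zeta(4)-(3d^2+3d+\tfrac56)\zeta(3)-(d+\tfrac12)\zeta(2)\\ &-\frac{12d^8-24d^7-216d^6-387d^5-339d^4-186d^3-72d^2-18d-2}{12d^6(d+1)^3}. \end{align*}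
   Context: For integers $b\ge 2$ and $0\le d<b$, $I(b,d,1)=\sum \frac1m$, where the sum runs over all integers $m>0$ whose base-$b$ representation (without leading zeros) contains exactly one occurrence of the digit $d$ (this series converges). $\zeta$ is the Riemann zeta function. A function $f$ of the integer $b$ has an asymptotic expansion to all orders in inverse powers of $b$ if there are coefficients $a_n$ independent of $b$ (but depending on $d$) such that for every $N$, $f(b)=\sum_{n\le N}a_nb^{-n}+O(b^{-N-1})$ as $b\to\infty$. *)

(* Defs.v *)
From HB Require Import structures.
From mathcomp Require Import all_boot all_order all_algebra.
From mathcomp Require Import all_classical all_reals all_analysis.

Set Implicit Arguments.
Unset Strict Implicit.
Unset Printing Implicit Defensive.

Import Order.TTheory GRing.Theory Num.Theory.
Import numFieldNormedType.Exports.

Local Open Scope classical_set_scope.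
Local Open Scope ring_scope.

(* The first argument is fuel; for 1 < b, m steps are enough to reach 0. *)
Fixpoint digits_rec (k b m : nat) : seq nat :=
  if k is k'.+1 then
    if (m == 0)%N then [::] else (m %% b)%N :: digits_rec k' b (m %/ b)%N
  else [::].

(* Least significant digit first; 0 has no digits. *)
Definition digits (b m : nat) : seq nat := digits_rec m b m.

Lemma digits_recP (b k m : nat) : (1 < b)%N -> (m <= k)%N ->
  [/\ foldr (fun c n => c + b * n)%N 0%N (digits_rec k b m) = m,
      all (fun c => c < b)%N (digits_rec k b m) &
      last 1%N (digits_rec k b m) != 0%N].
Proof.
move=> b_gt1; elim: k m => [|k IHk] m /=; first by rewrite leqn0 => /eqP ->.
case: eqVneq => [-> //|m_neq0] le_mk /=.
have m_gt0 : (0 < m)%N by rewrite lt0n.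
have [|valE allE lastE] := IHk (m %/ b)%N.
  by rewrite -ltnS (leq_trans (ltn_Pdiv b_gt1 m_gt0)).
split.
- by rewrite valE addnC mulnC -divn_eq.
- by rewrite ltn_mod (ltnW b_gt1).
case: (digits_rec k b (m %/ b)) valE lastE => [|c s] //= /esym div0 _.
by apply: contra_neq m_neq0 => mod0; rewrite (divn_eq m b) div0 mod0.
Qed.

(* [digits b m] is the base-[b] representation of [m] without leading zeros. *)
Lemma digitsP (b m : nat) : (1 < b)%N ->
  [/\ foldr (fun c n => c + b * n)%N 0%N (digits b m) = m,
      all (fun c => c < b)%N (digits b m) &
      last 1%N (digits b m) != 0%N].
Proof. by move=> b_gt1; apply: digits_recP. Qed.

(* I(b, d, k): sum of 1/m over the m > 0 having exactly k digits d in base b. *)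
Definition irwin (R : realType) (b d k : nat) : R :=
  \big[+%R/0]_(1 <= m <oo | count_mem d (digits b m) == k) (m%:R^-1 : R).

(* The Dirichlet series; equal to the Riemann zeta function at integers s > 1. *)
Definition zeta (R : realType) (s : nat) : R :=
  \big[+%R/0]_(1 <= n <oo) ((n%:R ^+ s)^-1 : R).

Definition has_asymptotic_expansion (R : realType) (f a : nat -> R) : Prop :=
  forall N : nat,
    (fun b : nat => f b - \sum_(n < N.+1) a n * b%:R ^- n)
      =O_\oo (fun b : nat => b%:R ^- N.+1 : R).

Section Coefficients.
Variables (R : realType) (d : nat).
Let x : R := d%:R.
Let h : R := x + 1 / 2.

Definition irwin1_coef1 : R := h / x ^+ 2.

Definition irwin1_coef2 : R :=
  - ((9 * x ^+ 2 + 8 * x + 2) / (6 * x ^+ 3 * (x + 1))).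

Definition irwin1_coef3 : R :=
  h * zeta R 2
  + h * ((2 * x ^+ 3 + 4 * x ^+ 2 + 4 * x + 1)
         / (2 * x ^+ 4 * (x + 1) ^+ 2)).

Definition irwin1_coef4 : R :=
  - ((2 * x + 1) * x * zeta R 3) + h * zeta R 2
  - (60 * x ^+ 7 + 180 * x ^+ 6 + 350 * x ^+ 5 + 585 * x ^+ 4
     + 597 * x ^+ 3 + 331 * x ^+ 2 + 96 * x + 12)
    / (60 * x ^+ 5 * (x + 1) ^+ 3).

Definition irwin1_coef5 : R :=
  3 * h * x ^+ 2 * zeta R 4
  - (3 * x ^+ 2 + 3 * x + 5 / 6) * zeta R 3 - h * zeta R 2
  - (12 * x ^+ 8 - 24 * x ^+ 7 - 216 * x ^+ 6 - 387 * x ^+ 5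
     - 339 * x ^+ 4 - 186 * x ^+ 3 - 72 * x ^+ 2 - 18 * x - 2)
    / (12 * x ^+ 6 * (x + 1) ^+ 3).

End Coefficients.

(* Main.v *)
Require Import Defs.
From HB Require Import structures.
From mathcomp Require Import all_boot all_order all_algebra.
From mathcomp Require Import all_classical all_reals all_analysis.
From mathcomp Require Import ring lra zify.
Import Order.TTheory GRing.Theory Num.Theory.
Import numFieldNormedType.Exports.
Local Open Scope classical_set_scope.
Local Open Scope ring_scope.
Set Implicit Arguments.
Unset Strict Implicit.
Unset Printing Implicit Defensive.

(** Write y = 1/b, z = 1/(d b + d) and h = d + 1/2.  A number m with at least two
    digits is A b^l + n, where A is made of its two leading digits and n < b^l
    is its tail of l digits, padded by zeros.  Expanding
    1/m = b^-l / (A + n/b^l) geometrically in (n/b^l)/A, with A >= b, turns the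
    sum over the tails into a sum over j of (-1)^j A^-(j+1) times the j-th
    moment of mu_1 if A has no digit d, of mu_0 if A has one, where mu_k puts
    mass b^-l at n/b^l for each string of l digits with exactly k digits d
    ([irwin_approx]).  Truncating at j < J costs O(b^(2-J)), so any order of
    accuracy needs finitely many moments only.

    Both mu_0 and mu_1 have mass b, and as b grows they are close to b times
    Lebesgue measure.  Lebesgue measure itself contributes b log b, since
    b log b is the sum over A of b log(1 + 1/A) ([ln_two_digit_approx]), up to
    the terms for the number A = dd, which form the alternating series of
    - b log(1 + z) and combine with the one-digit term 1/d ([log_part]).
    What remains is the sum of (-1)^j (beta_j N0_(j+1) + alpha_j N1_(j+1)),
    where alpha_j and beta_j are the deviations from b/(j+1) of the moments of
    mu_0 and mu_1 ([dev]), and Nk_s is the sum of A^-s over the two-digit A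
    with k digits d ([dev_part], [irwin_decomposition]).

    All these quantities have expansions in powers of y.  Splitting off the
    leading digit of a string gives triangular recurrences for the deviations
    ([dev_rec]), which show moreover that alpha_j = O(y), beta_j = O(y^3), with
    one more order for j > 1.  The sums N0_s and N1_s reduce, for s > 1, to tails
    of the series zeta(s) at b, b^2, d b and (d + 1) b, and to the sum of
    (a b + d)^-s over 0 < a < b, whose expansion in 1/(a b) produces the values
    zeta(s), zeta(s + 1), and so on.  The tails are expanded by telescoping
    ([zeta_tail_approx], [expandable_zeta_tail]).  No harmonic number (the case
    s = 1) appears, because alpha_0 = beta_0 = 0.

    Modulo y^6, only alpha_1, beta_1, alpha_2 and alpha_3 matter:
    alpha_1 = - h (y + y^2 - y^4) + O(y^5), beta_1 = - h (y^3 + 2 y^4) + O(y^5),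
    alpha_2 = - (d^2 + 2 d + 5/6) y^2 + O(y^4), alpha_3 = - h y^2 + O(y^3), and
    multiplying by the leading terms of N0_2, N1_2, N1_3 and N1_4 gives the
    stated coefficients ([irwin_approx6]). *)

(** * Functions of b with expansions in inverse powers of b *)

Section InversePowers.
Variable R : realType.
Implicit Types (f g : nat -> R) (p q : {poly R}) (M N : nat).

(** f b = O(b^-N) as b tends to infinity. *)
Definition Oinv N f : Prop :=
  exists C : R, \forall b \near \oo, `|f b| <= C * b%:R^-1 ^+ N.

(** f has an asymptotic expansion to all orders.  The polynomials for the various
    N are not required to be compatible; their coefficients of degree less than
    N agree by uniqueness ([expandable_has_expansion]). *)
Definition expandable f : Prop :=
  forall N, exists p : {poly R}, Oinv N (fun b => f b - p.[b%:R^-1]).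

Lemma OinvP N f : Oinv N f -> f =O_\oo (fun b : nat => b%:R ^- N : R).
Proof.
move=> [C fC]; apply/eqO_exP; exists (Num.max C 1); first by rewrite lt_max ltr01 orbT.
near=> b.
rewrite normfV normrX ger0_norm ?ler0n//.
have /le_trans : `|f b| <= C * b%:R^-1 ^+ N by near: b.
by apply; rewrite exprVn ler_wpM2r ?invr_ge0 ?exprn_ge0 ?ler0n// le_max lexx.
Unshelve. all: by end_near. Qed.

Lemma invn_le1 b : (b%:R^-1 : R) <= 1.
Proof. by case: b => [|b]; rewrite ?invr0 ?ler01// invf_le1 ?ltr0n// ler1n. Qed.

Lemma Oinv_ge0 N f : Oinv N f ->
  exists2 C : R, 0 <= C & \forall b \near \oo, `|f b| <= C * b%:R^-1 ^+ N.
Proof.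
move=> [C fC]; exists (Num.max C 0); first by rewrite le_max lexx orbT.
apply: filterS fC => b /le_trans; apply.
by rewrite ler_wpM2r ?exprn_ge0 ?invr_ge0 ?ler0n// le_max lexx.
Qed.

Lemma Oinv_near N f g : (\forall b \near \oo, f b = g b) -> Oinv N f -> Oinv N g.
Proof.
move=> fg [C fC]; exists C.
by apply: filterS2 fg fC => b ->.
Qed.

Lemma Oinv_ext N f g : f =1 g -> Oinv N f -> Oinv N g.
Proof. by move=> /funext ->. Qed.

Lemma Oinv_bound N (C : R) (B : nat) f :
  (forall b, (B <= b)%N -> `|f b| <= C * b%:R^-1 ^+ N) -> Oinv N f.
Proof. by move=> fC; exists C; exists B. Qed.

Lemma Oinv_le M N f : (M <= N)%N -> Oinv N f -> Oinv M f.
Proof.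
move=> MN /Oinv_ge0[C C0 fC]; exists C; apply: filterS fC => b /le_trans; apply.
by rewrite ler_wpM2l// ler_wiXn2l ?invn_le1// invr_ge0 ler0n.
Qed.

Lemma Oinv0 N : Oinv N (fun=> 0).
Proof. by apply: (@Oinv_bound _ 0 0%N) => b _; rewrite normr0 mul0r. Qed.

Lemma OinvD N f g : Oinv N f -> Oinv N g -> Oinv N (fun b => f b + g b).
Proof.
move=> [C fC] [D gD]; exists (C + D); apply: filterS2 fC gD => b fC gD.
by rewrite mulrDl (le_trans (ler_normD _ _))// lerD.
Qed.

Lemma OinvN N f : Oinv N f -> Oinv N (fun b => - f b).
Proof. by move=> [C fC]; exists C; apply: filterS fC => b; rewrite normrN. Qed.

Lemma OinvB N f g : Oinv N f -> Oinv N g -> Oinv N (fun b => f b - g b).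
Proof. by move=> fN gN; apply: OinvD => //; apply: OinvN. Qed.

Lemma OinvM M N f g : Oinv M f -> Oinv N g -> Oinv (M + N) (fun b => f b * g b).
Proof.
move=> [C fC] [D gD]; exists (C * D); apply: filterS2 fC gD => b fC gD.
by rewrite normrM exprD mulrACA ler_pM.
Qed.

Lemma Oinv_cst (c : R) : Oinv 0 (fun=> c).
Proof. by apply: (@Oinv_bound _ `|c| 0%N) => b _; rewrite expr0 mulr1. Qed.

Lemma Oinv_exp N : Oinv N (fun b => b%:R^-1 ^+ N).
Proof.
apply: (@Oinv_bound _ 1 0%N) => b _.
by rewrite mul1r ger0_norm// exprn_ge0 ?invr_ge0 ?ler0n.
Qed.

Lemma Oinv_inv : Oinv 1 (fun b => b%:R^-1).
Proof. exact: Oinv_ext (Oinv_exp 1). Qed.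

Lemma OinvMl N f g : Oinv 0 f -> Oinv N g -> Oinv N (fun b => f b * g b).
Proof. by move=> f0 gN; have := OinvM f0 gN. Qed.

Lemma OinvZ N (c : R) g : Oinv N g -> Oinv N (fun b => c * g b).
Proof. by move=> gN; apply: OinvMl => //; apply: Oinv_cst. Qed.

Lemma OinvX N f k : Oinv N f -> Oinv (k * N) (fun b => f b ^+ k).
Proof.
move=> fN; elim: k => [|k IHk].
  by apply: Oinv_ext (Oinv_cst 1) => b; rewrite expr0.
by rewrite mulSn; apply: Oinv_ext (OinvM fN IHk) => b; rewrite exprS.
Qed.

Lemma Oinv_sum (I : Type) (r : seq I) (P : pred I) N (F : I -> nat -> R) :
  (forall i, P i -> Oinv N (F i)) -> Oinv N (fun b => \sum_(i <- r | P i) F i b).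
Proof.
move=> FN; elim: r => [|i r IHr].
  by apply: Oinv_ext (Oinv0 N) => b; rewrite big_nil.
have [Pi|Pi] := boolP (P i).
  by apply: Oinv_ext (OinvD (FN _ Pi) IHr) => b; rewrite big_cons Pi.
by apply: Oinv_ext IHr => b; rewrite big_cons (negbTE Pi).
Qed.

Lemma Oinv_div N f : Oinv N.+1 (fun b => b%:R^-1 * f b) -> Oinv N f.
Proof.
move=> [C fC]; exists C; near=> b.
have b0 : 0 < b%:R^-1 :> R by rewrite invr_gt0 ltr0n; near: b; exists 1%N.
rewrite -(ler_pM2l b0) mulrCA -exprS -{1}(gtr0_norm b0) -normrM.
by near: b.
Unshelve. all: by end_near. Qed.

Lemma OinvB_trans N f g h : Oinv N (fun b => f b - g b) ->
  Oinv N (fun b => g b - h b) -> Oinv N (fun b => f b - h b).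
Proof.
by move=> fg gh; apply: Oinv_ext (OinvD fg gh) => b; rewrite addrA subrK.
Qed.

(** Congruence of products, the accuracy of one factor being raised by the
   order of the other one. *)
Lemma OinvMB i j N (f f' g g' : nat -> R) :
  Oinv i f -> Oinv (N - i) (fun b => g b - g' b) ->
  Oinv j g' -> Oinv (N - j) (fun b => f b - f' b) ->
  Oinv N (fun b => f b * g b - f' b * g' b).
Proof.
move=> fi gg' g'j ff'.
apply: (@Oinv_ext _ (fun b => f b * (g b - g' b) + (f b - f' b) * g' b)).
  by move=> b; ring.
apply: OinvD; first by apply: Oinv_le (OinvM fi gg'); lia.
by apply: Oinv_le (OinvM ff' g'j); lia.
Qed.

Lemma Oinv_horner p : Oinv 0 (fun b => p.[b%:R^-1]).
Proof.
elim/poly_ind: p => [|p c IHp].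
  by apply: Oinv_ext (Oinv0 0) => b; rewrite horner0.
apply: (@Oinv_ext _ (fun b => p.[b%:R^-1] * b%:R^-1 + c)).
  by move=> b; rewrite hornerMXaddC.
apply: OinvD; last exact: Oinv_cst.
by apply: OinvMl => //; apply: Oinv_le (Oinv_inv).
Qed.

Lemma Oinv_cvg0 f : Oinv 1 f -> f b @[b --> \oo] --> 0.
Proof.
move=> [C fC].
apply/cvgr0Pnorm_le => e e0; near=> b.
have b0 : 0 < b%:R :> R by rewrite ltr0n; near: b; exists 1%N.
have /le_trans : `|f b| <= C * b%:R^-1 ^+ 1 by near: b.
apply; rewrite expr1 ler_pdivrMr// mulrC -ler_pdivrMr//.
by near: b; apply: nbhs_infty_ger; rewrite num_real.
Unshelve. all: by end_near. Qed.

Lemma cvg_sumr (I : Type) (r : seq I) (P : pred I) (F : I -> nat -> R) (l : I -> R) :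
  (forall i, P i -> F i n @[n --> \oo] --> l i) ->
  \sum_(i <- r | P i) F i n @[n --> \oo] --> \sum_(i <- r | P i) l i.
Proof. by move=> Fl; apply: cvg_big => //; exact: add_continuous. Qed.

Lemma cvg_dist_le (u v : nat -> R) (x y e : R) :
  u n @[n --> \oo] --> x -> v n @[n --> \oo] --> y ->
  (forall n, `|u n - v n| <= e) -> `|x - y| <= e.
Proof.
move=> ux vy uve.
have uv : `|u n - v n| @[n --> \oo] --> `|x - y| by apply: cvg_norm; exact: cvgB.
rewrite -(cvg_lim _ uv)//; apply: limr_le; first by apply/cvg_ex; exists `|x - y|.
exact: nearW.
Qed.

Lemma Oinv_cst_eq0 (c : R) : Oinv 1 (fun=> c) -> c = 0.
Proof.
move=> /Oinv_cvg0 c0.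
by apply/esym; apply: (cvg_unique _ c0); [exact: Rhausdorff|exact: cvg_cst].
Qed.

(** Uniqueness of the coefficients of an asymptotic expansion. *)
Lemma Oinv_horner_coef N p : Oinv N (fun b => p.[b%:R^-1]) ->
  forall i, (i < N)%N -> p`_i = 0.
Proof.
elim: N p => // N IHN; elim/poly_ind => [|p c _]; first by move=> _ i; rewrite coef0.
move=> pO.
have pOc : Oinv N.+1 (fun b => b%:R^-1 * p.[b%:R^-1] + c).
  by apply: Oinv_ext pO => b; rewrite hornerMXaddC mulrC.
have c0 : c = 0.
  apply: Oinv_cst_eq0.
  have cO := Oinv_le (ltn0Sn N) pOc.
  have pO' := OinvM Oinv_inv (Oinv_horner p).
  apply: Oinv_ext (OinvB cO pO') => b /=.
  by rewrite addrC addKr.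
rewrite c0 in pOc *; move=> [|i]; first by rewrite coefD coefMX coefC/= addr0.
rewrite ltnS coefD coefMX coefC/= addr0 => iN; apply: IHN => //.
by apply: Oinv_div; apply: Oinv_ext pOc => b; rewrite addr0.
Qed.

Lemma Oinv_coef_horner N p :
  (forall i, (i < N)%N -> p`_i = 0) -> Oinv N (fun b => p.[b%:R^-1]).
Proof.
move=> p0.
apply: (@Oinv_ext _ (fun b => b%:R^-1 ^+ N * (drop_poly N p).[b%:R^-1])).
  move=> b; rewrite -[in RHS](poly_take_drop N p).
  have -> : take_poly N p = 0.
    apply/polyP => i; rewrite coef_take_poly coef0.
    by case: ltnP => // /p0.
  by rewrite add0r hornerM hornerXn mulrC.
by have := OinvM (Oinv_exp N) (Oinv_horner (drop_poly N p)); rewrite addn0.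
Qed.

Lemma expandable_near f g :
  (\forall b \near \oo, f b = g b) -> expandable f -> expandable g.
Proof.
move=> fg fE N; have [p fp] := fE N; exists p; apply: Oinv_near fp.
by apply: filterS fg => b ->.
Qed.

Lemma expandable_ext f g : f =1 g -> expandable f -> expandable g.
Proof. by move=> /funext ->. Qed.

Lemma expandable_horner p : expandable (fun b => p.[b%:R^-1]).
Proof. by move=> N; exists p; apply: Oinv_ext (Oinv0 N) => b; rewrite subrr. Qed.

Lemma expandable_cst c : expandable (fun=> c).
Proof. by apply: expandable_ext (expandable_horner c%:P) => b; rewrite hornerC. Qed.

Lemma expandable_inv : expandable (fun b => b%:R^-1).
Proof. by apply: expandable_ext (expandable_horner 'X) => b; rewrite hornerX. Qed.

Lemma expandableD f g :
  expandable f -> expandable g -> expandable (fun b => f b + g b).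
Proof.
move=> fE gE N; have [p fp] := fE N; have [q gq] := gE N; exists (p + q).
by apply: Oinv_ext (OinvD fp gq) => b; rewrite hornerD; ring.
Qed.

Lemma expandable_Oinv0 f : expandable f -> Oinv 0 f.
Proof.
move=> /(_ 0%N)[p fp].
by apply: Oinv_ext (OinvD fp (Oinv_horner p)) => b; rewrite subrK.
Qed.

Lemma expandableM f g :
  expandable f -> expandable g -> expandable (fun b => f b * g b).
Proof.
move=> fE gE N; have [p fp] := fE N; have [q gq] := gE N; exists (p * q).
apply: (@Oinv_ext _ (fun b => f b * g b - p.[b%:R^-1] * q.[b%:R^-1])).
  by move=> b; rewrite hornerM.
by apply: (@OinvMB 0 0); rewrite ?subn0//;
  [exact: expandable_Oinv0 | exact: Oinv_horner].
Qed.

Lemma expandableZ c f : expandable f -> expandable (fun b => c * f b).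
Proof. by move=> fE; apply: expandableM => //; apply: expandable_cst. Qed.

Lemma expandableN f : expandable f -> expandable (fun b => - f b).
Proof. by move=> /(expandableZ (-1)); apply: expandable_ext => b; rewrite mulN1r. Qed.

Lemma expandableB f g :
  expandable f -> expandable g -> expandable (fun b => f b - g b).
Proof. by move=> fE gE; apply: expandableD => //; apply: expandableN. Qed.

Lemma expandableX f k : expandable f -> expandable (fun b => f b ^+ k).
Proof.
move=> fE; elim: k => [|k IHk].
  by apply: expandable_ext (expandable_cst 1) => b; rewrite expr0.
by apply: expandable_ext (expandableM fE IHk) => b; rewrite exprS.
Qed.

Lemma expandable_sum (I : Type) (r : seq I) (P : pred I) (F : I -> nat -> R) :
  (forall i, P i -> expandable (F i)) -> expandable (fun b => \sum_(i <- r | P i) F i b).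
Proof.
move=> FE; elim: r => [|i r IHr].
  by apply: expandable_ext (expandable_cst 0) => b; rewrite big_nil.
have [Pi|Pi] := boolP (P i).
  by apply: expandable_ext (expandableD (FE _ Pi) IHr) => b; rewrite big_cons Pi.
by apply: expandable_ext IHr => b; rewrite big_cons (negbTE Pi).
Qed.

Lemma expandable_approx f :
  (forall N, exists2 g, expandable g & Oinv N (fun b => f b - g b)) -> expandable f.
Proof.
move=> fE N; have [g gE fg] := fE N; have [p gp] := gE N; exists p.
exact: OinvB_trans fg gp.
Qed.

Lemma near_geom g : Oinv 1 g -> \forall b \near \oo, `|g b| <= 2^-1.
Proof. by move=> /Oinv_cvg0 /cvgr0Pnorm_le; apply; rewrite invr_gt0 ltr0n. Qed.

Lemma Oinv_geom g : Oinv 1 g -> Oinv 0 (fun b => (1 - g b)^-1).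
Proof.
move=> /near_geom g1; exists 2; apply: filterS g1 => b gb.
have : 2^-1 <= 1 - g b by have := ler_norm (g b); lra.
move=> h; have h0 : 0 < 1 - g b by apply: lt_le_trans h; rewrite invr_gt0 ltr0n.
rewrite expr0 mulr1 normfV gtr0_norm// -[leRHS]invrK lef_pV2//.
by rewrite posrE invr_gt0 ltr0n.
Qed.

Lemma Oinv_geomB N g : Oinv 1 g ->
  Oinv N (fun b => (1 - g b)^-1 - \sum_(i < N) g b ^+ i).
Proof.
move=> g1; apply: (@Oinv_near _ (fun b => (1 - g b)^-1 * g b ^+ N)).
  near=> b.
  have gb : `|g b| <= 2^-1 by near: b; exact: near_geom.
  have u : 1 - g b != 0 by have gb1 := ler_norm (g b); apply/eqP; lra.
  apply: (mulfI u); rewrite mulrA mulrBr mulfV// mul1r.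
  by rewrite -[X in X * \sum_(_ < _) _]opprB mulNr -subrX1; ring.
by apply: OinvMl; [exact: Oinv_geom | rewrite -[N in Oinv N]muln1; exact: OinvX].
Unshelve. all: by end_near. Qed.

Lemma expandable_geom g :
  Oinv 1 g -> expandable g -> expandable (fun b => (1 - g b)^-1).
Proof.
move=> g1 gE; apply: expandable_approx => N.
exists (fun b => \sum_(i < N) g b ^+ i); last exact: Oinv_geomB.
by apply: expandable_sum => i _; apply: expandableX.
Qed.

(** Uniqueness of coefficients glues the polynomial approximations of f into a
    single sequence, whose first terms are those of any approximation q. *)
Lemma expandable_has_expansion N f q :
  expandable f -> Oinv N (fun b => f b - q.[b%:R^-1]) ->
  exists2 a, has_asymptotic_expansion f a & forall i, (i < N)%N -> a i = q`_i.
Proof.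
move=> fE fq.
have /choice[P fP] : forall n, exists p : {poly R}, Oinv n (fun b => f b - p.[b%:R^-1]) by [].
have PP n m i : (i < n)%N -> (i < m)%N -> (P n)`_i = (P m)`_i.
  move=> ni mi; apply/eqP; rewrite -subr_eq0 -coefB; apply/eqP.
  apply: (@Oinv_horner_coef i.+1) => //.
  apply: Oinv_ext (OinvB (Oinv_le mi (fP m)) (Oinv_le ni (fP n))) => b.
  by rewrite hornerD hornerN; ring.
exists (fun n => (P n.+1)`_n) => [n|i iN]; last first.
  apply/eqP; rewrite -subr_eq0 -coefB; apply/eqP.
  apply: (@Oinv_horner_coef i.+1) => //.
  apply: Oinv_ext (OinvB (Oinv_le iN fq) (fP i.+1)) => b.
  by rewrite hornerD hornerN; ring.
apply: OinvP.
pose s : {poly R} := \poly_(i < n.+1) (P i.+1)`_i.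
apply: (@Oinv_ext _ (fun b => f b - s.[b%:R^-1])).
  move=> b; rewrite horner_poly; congr (_ - _); apply: eq_bigr => i _.
  by rewrite exprVn.
have sP : Oinv n.+1 (fun b => (P n.+1 - s).[b%:R^-1]).
  apply: Oinv_coef_horner => i ni; rewrite coefB coef_poly ni.
  by rewrite (PP n.+1 i.+1)// subrr.
by apply: Oinv_ext (OinvD (fP n.+1) sP) => b; rewrite hornerD hornerN; ring.
Qed.

Lemma Oinv_comp N f (g : nat -> nat) : (\forall b \near \oo, (b <= g b)%N) ->
  Oinv N f -> Oinv N (fun b => f (g b)).
Proof.
move=> gb /Oinv_ge0[C C0 [B _ fC]]; exists C; near=> b.
have bgb : (b <= g b)%N by near: b.
have b0 : (0 < b)%N by near: b; exists 1%N.
apply: (le_trans (fC _ _)).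
  by apply: leq_trans bgb; near: b; exists B.
rewrite ler_wpM2l// lerXn2r ?nnegrE ?invr_ge0 ?ler0n//.
by rewrite lef_pV2 ?posrE ?ltr0n ?ler_nat// (leq_trans b0).
Unshelve. all: by end_near. Qed.

Lemma expandable_comp f (g : nat -> nat) : (\forall b \near \oo, (b <= g b)%N) ->
  expandable (fun b => (g b)%:R^-1) ->
  expandable f -> expandable (fun b => f (g b)).
Proof.
move=> gb gE fE; apply: expandable_approx => N.
have [p fp] := fE N; exists (fun b => p.[(g b)%:R^-1]); last first.
  exact: (@Oinv_comp N (fun b => f b - p.[b%:R^-1])).
elim/poly_ind: p {fp} => [|p c IHp].
  by apply: expandable_ext (expandable_cst 0) => b; rewrite horner0.
apply: (@expandable_ext (fun b => p.[(g b)%:R^-1] * (g b)%:R^-1 + c)).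
  by move=> b; rewrite hornerMXaddC.
by apply: expandableD; [exact: expandableM | exact: expandable_cst].
Qed.

End InversePowers.

(** * Tails of the zeta series *)

Section ZetaTails.
Variable R : realType.
Implicit Types (f g h : nat -> R) (s n N K : nat).

Lemma succ_inv n : (0 < n)%N -> n.+1%:R^-1 = n%:R^-1 * (1 + n%:R^-1)^-1 :> R.
Proof.
move=> n0; have nR : 0 < n%:R :> R by rewrite ltr0n.
by rewrite -natr1; field; rewrite !gt_eqF//; lra.
Qed.

Lemma inv_pow_telescope K n : (0 < K)%N -> (0 < n)%N ->
  n%:R^-1 ^+ K.+1 <= 2 * (n%:R^-1 ^+ K - n.+1%:R^-1 ^+ K) :> R.
Proof.
move=> K0 n0; rewrite succ_inv// exprMn; set y : R := n%:R^-1.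
have y0 : 0 <= y by rewrite invr_ge0 ler0n.
have y1 : y <= 1 by exact: invn_le1.
rewrite -[X in X - _]mulr1 -mulrBr mulrCA exprSr ler_wpM2l ?exprn_ge0//.
have w1 : (1 + y)^-1 <= 1 by rewrite invf_le1; lra.
have w0 : 0 <= (1 + y)^-1 by rewrite invr_ge0; lra.
have : (1 + y)^-1 ^+ K <= (1 + y)^-1 ^+ 1 by rewrite ler_wiXn2l.
suff : (1 + y)^-1 <= 1 - y / 2 by rewrite expr1; lra.
rewrite -[leLHS]mul1r ler_pdivrMr; nra.
Qed.

(** A null sequence whose differences are O(n^-(K+1)) is O(n^-K). *)
Lemma Oinv_telescope K h : (0 < K)%N -> h n @[n --> \oo] --> 0 ->
  Oinv K.+1 (fun n => h n - h n.+1) -> Oinv K h.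
Proof.
move=> K0 h0 /Oinv_ge0[C C0 [B _ hC]].
apply: (@Oinv_bound _ _ (2 * C) B.+1) => n nB.
have n0 : (0 < n)%N by apply: leq_trans nB.
have step k : `|h n - h (n + k)%N| <= 2 * C * (n%:R^-1 ^+ K - (n + k)%:R^-1 ^+ K).
  elim: k => [|k IHk]; first by rewrite addn0 !subrr normr0 mulr0.
  rewrite -(subrK (h (n + k)%N) (h n)) -addrA (le_trans (ler_normD _ _))//.
  have {}hC : `|h (n + k)%N - h (n + k.+1)%N| <= C * (n + k)%:R^-1 ^+ K.+1.
    by rewrite addnS; apply: hC => /=; lia.
  have := @inv_pow_telescope K (n + k) K0 (leq_trans n0 (leq_addr _ _)).
  move=> /(ler_wpM2l C0); rewrite -addnS.
  by lra.
have step' k : `|h n - h (n + k)%N| <= 2 * C * n%:R^-1 ^+ K.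
  apply: le_trans (step k) _; rewrite ler_wpM2l ?mulr_ge0//.
  by rewrite gerBl exprn_ge0// invr_ge0 ler0n.
rewrite -[h n]subr0; apply: cvg_dist_le (step').
  exact: cvg_cst.
have := h0; rewrite -(cvg_shiftn n); apply: cvg_trans.
by under eq_fun do rewrite addnC.
Qed.

(** The sum of a^-s over a >= n, for n > 0. *)
Definition zeta_tail s n : R := zeta R s - \sum_(1 <= a < n) (a%:R ^+ s)^-1.

Lemma zeta_sum_le s n : (1 < s)%N -> \sum_(1 <= a < n) (a%:R ^+ s)^-1 <= 2 :> R.
Proof.
move=> s1.
have H k : \sum_(1 <= a < k.+1) (a%:R ^+ s)^-1 <= 2 * (1 - k.+1%:R^-1) :> R.
  elim: k => [|k IHk]; first by rewrite big_nil invr1 subrr mulr0.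
  rewrite big_nat_recr//=.
  have := @inv_pow_telescope 1 k.+1 isT isT; rewrite !expr1.
  have : (k.+1%:R ^+ s)^-1 <= k.+1%:R^-1 ^+ 2 :> R.
    by rewrite -exprVn ler_wiXn2l// ?invr_ge0 ?ler0n// invn_le1.
  move: IHk; move: (\sum_(1 <= a < k.+1) _) ((_ ^+ s)^-1) (k.+1%:R^-1 ^+ 2) => S t u.
  by move: (k.+1%:R^-1) (k.+2%:R^-1) => v w; lra.
case: n => [|n]; first by rewrite big_geq.
apply: le_trans (H n) _.
by rewrite -[leRHS]mulr1 ler_wpM2l// gerBl invr_ge0.
Qed.

Lemma zeta_tail_cvg0 s : (1 < s)%N -> zeta_tail s n @[n --> \oo] --> 0.
Proof.
move=> s1; rewrite /zeta_tail.
rewrite -[X in _ --> X](subrr (zeta R s)).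
apply: cvgB; first exact: cvg_cst.
rewrite /zeta; apply: nondecreasing_is_cvgn.
  apply/nondecreasing_seqP => n.
  case: n => [|n]; first by rewrite !big_geq.
  by rewrite [leRHS]big_nat_recr//= lerDl invr_ge0 exprn_ge0.
by exists 2 => _ [n _ <-]; exact: zeta_sum_le.
Qed.

Lemma zeta_tailB s n m : (0 < n)%N -> (n <= m)%N ->
  zeta_tail s n - zeta_tail s m = \sum_(n <= a < m) (a%:R ^+ s)^-1.
Proof. by move=> n0 nm; rewrite /zeta_tail (big_cat_nat n0 nm)/=; ring. Qed.

Lemma zeta_tail_diff s n : (0 < n)%N ->
  zeta_tail s n - zeta_tail s n.+1 = n%:R^-1 ^+ s.
Proof. by move=> n0; rewrite zeta_tailB// big_nat1 exprVn. Qed.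

Lemma Oinv_zeta_tail s : (1 < s)%N -> Oinv s.-1 (zeta_tail s).
Proof.
case: s => [|[|s]]// s1; apply: Oinv_telescope => //; first exact: zeta_tail_cvg0.
apply: Oinv_near (Oinv_exp R s.+2); exists 1%N => // n n0.
by rewrite zeta_tail_diff.
Qed.

(** The error of f as an approximation of the tail is governed by that of
    f n - f (n + 1) as an approximation of n^-s. *)
Lemma zeta_tail_approx s N f : (1 < s)%N -> Oinv 1 f ->
  Oinv N.+2 (fun n => n%:R^-1 ^+ s - (f n - f n.+1)) ->
  Oinv N.+1 (fun n => zeta_tail s n - f n).
Proof.
move=> s1 f1 fN; apply: Oinv_telescope => //.
  by rewrite -[X in _ --> X](subrr 0); apply: cvgB;
    [exact: zeta_tail_cvg0 | exact: Oinv_cvg0].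
apply: Oinv_near fN; exists 1%N => // n n0.
by rewrite -zeta_tail_diff//; ring.
Qed.

Lemma expandable_1Dinv (c : R) : expandable (fun n => (1 + c * n%:R^-1)^-1).
Proof.
apply: (@expandable_ext _ (fun n => (1 - (- c) * n%:R^-1)^-1)).
  by move=> n; rewrite mulNr opprK.
apply: expandable_geom; first by apply: OinvZ; exact: Oinv_inv.
by apply: expandableZ; exact: expandable_inv.
Qed.

Lemma Oinv_1Dinv (c : R) : Oinv 0 (fun n => (1 + c * n%:R^-1)^-1).
Proof. by apply: expandable_Oinv0; exact: expandable_1Dinv. Qed.

(** The remainder after the leading term m n^-(m+1) is n^-(m+2) times an
    expandable function. *)
Lemma inv_pow_diff m n : (0 < n)%N ->
  n%:R^-1 ^+ m - n.+1%:R^-1 ^+ m = m%:R * n%:R^-1 ^+ m.+1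
    - n%:R^-1 ^+ m.+2 *
      \sum_(i < m) \sum_(l < i.+1) (1 + 1 * n%:R^-1)^-1 ^+ l.+1 :> R.
Proof.
move=> n0; rewrite succ_inv// exprMn mul1r; set y : R := n%:R^-1.
set w := (1 + y)^-1.
have wE : 1 - w = y * w.
  rewrite /w; have y0 : 0 <= y by rewrite invr_ge0 ler0n.
  by field; rewrite gt_eqF//; lra.
have w_pow k : 1 - w ^+ k = y * \sum_(l < k) w ^+ l.+1.
  rewrite -opprB subrX1 -mulNr opprB wE -mulrA mulr_sumr.
  by congr (_ * _); apply: eq_bigr => l _; rewrite exprS.
rewrite -{1}[y ^+ m]mulr1 -mulrBr w_pow.
have -> : \sum_(l < m) w ^+ l.+1 = m%:R - y * \sum_(i < m) \sum_(l < i.+1) w ^+ l.+1.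
  rewrite mulr_sumr -[X in X%:R]card_ord -sum1_card natr_sum -sumrB.
  by apply: eq_bigr => i _; rewrite -w_pow opprB addrC subrK.
by rewrite mulrBr !exprSr; ring.
Qed.

(** By [inv_pow_diff], the tail of exponent s is n^(1-s)/(s - 1) plus a combination
    of tails of larger exponents, up to O(n^-N); tails with s > N are negligible,
    whence a downward induction on s. *)
Lemma expandable_zeta_tail s : (1 < s)%N -> expandable (zeta_tail s).
Proof.
move=> s1 N; have [k Nk] : exists k, (N <= s.-1 + k)%N by exists N; exact: leq_addl.
elim: k s s1 Nk => [|k IHk] s s1 Nk.
  (* here s > N, and the zero polynomial will do *)
  exists 0; apply: Oinv_ext (Oinv_le _ (Oinv_zeta_tail s1)); last by rewrite addn0 in Nk.
  by move=> n; rewrite horner0 subr0.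
case: N IHk Nk => [|N] IHk Nk.
  exists 0; apply: Oinv_ext (Oinv_le (leq0n _) (Oinv_zeta_tail s1)).
  by move=> n; rewrite horner0 subr0.
case: s s1 Nk => [|m]// m0 Nk; rewrite /= ltnS in m0 Nk.
pose r n : R := \sum_(i < m) \sum_(l < i.+1) (1 + 1 * n%:R^-1)^-1 ^+ l.+1.
have rE : expandable r.
  apply: expandable_sum => i _; apply: expandable_sum => l _.
  by apply: expandableX; exact: expandable_1Dinv.
have [p rp] := rE N.
have /choice[q qP] : forall i, exists q : {poly R},
    Oinv N.+1 (fun n => zeta_tail (m.+2 + i) n - q.[n%:R^-1]).
  by move=> i; apply: IHk; [|rewrite /=]; lia.
have mR : m%:R != 0 :> R by rewrite pnatr_eq0 -lt0n.
exists (m%:R^-1 *: ('X^m + \sum_(i < size p) p`_i *: q i)).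
(* the same combination, with the tails in place of their expansions *)
pose f n : R := m%:R^-1 *
  (n%:R^-1 ^+ m + \sum_(i < size p) p`_i * zeta_tail (m.+2 + i) n).
apply: (@OinvB_trans _ _ _ f); last first.
  apply: (@Oinv_ext _ _ (fun n => m%:R^-1 *
      \sum_(i < size p) p`_i * (zeta_tail (m.+2 + i) n - (q i).[n%:R^-1]))).
    move=> n; rewrite hornerZ hornerD hornerXn horner_sum /f -mulrBr.
    congr (_ * _); rewrite addrAC opprD addrA subrr add0r -sumrN.
    rewrite addrC -big_split/=; apply: eq_bigr => i _.
    by rewrite hornerZ; ring.
  by apply: OinvZ; apply: Oinv_sum => i _; apply: OinvZ.
apply: zeta_tail_approx => //.
  apply: OinvZ; apply: OinvD; first exact: Oinv_le (Oinv_exp R m).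
  apply: Oinv_sum => i _; apply: OinvZ.
  by apply: Oinv_le (Oinv_zeta_tail _); rewrite addSn//.
apply: (@Oinv_near _ _ (fun n => m%:R^-1 * (n%:R^-1 ^+ m.+2 * (r n - p.[n%:R^-1])))).
  exists 1%N => // n n0; rewrite /f -mulrBr.
  apply: (mulfI mR); rewrite mulVKf// [RHS]mulrBr mulVKf//.
  have -> : n%:R^-1 ^+ m + \sum_(i < size p) p`_i * zeta_tail (m.+2 + i) n
     - (n.+1%:R^-1 ^+ m + \sum_(i < size p) p`_i * zeta_tail (m.+2 + i) n.+1) =
     m%:R * n%:R^-1 ^+ m.+1 - n%:R^-1 ^+ m.+2 * (r n - p.[n%:R^-1]).
    rewrite opprD addrACA inv_pow_diff// -/(r n).
    have -> : \sum_(i < size p) p`_i * zeta_tail (m.+2 + i) n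
        - \sum_(i < size p) p`_i * zeta_tail (m.+2 + i) n.+1
        = n%:R^-1 ^+ m.+2 * p.[n%:R^-1].
      rewrite horner_coef mulr_sumr -sumrB; apply: eq_bigr => i _.
      by rewrite -mulrBr zeta_tail_diff// exprD; ring.
    by ring.
  by ring.
apply: OinvZ; apply: Oinv_le (OinvM (Oinv_exp R m.+2) rp); lia.
Qed.

Lemma Oinv_succ_rational N (c : nat -> R) k (g : nat -> R) : Oinv 0 c ->
  (forall n, (0 < n)%N -> g n = n%:R^-1 ^+ N * (c n * (1 + 1 * n%:R^-1)^-1 ^+ k)) ->
  Oinv N g.
Proof.
move=> c0 gE.
apply: (@Oinv_near _ _ (fun n => n%:R^-1 ^+ N * (c n * (1 + 1 * n%:R^-1)^-1 ^+ k))).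
  by exists 1%N => // n n0; rewrite gE.
rewrite -[N]addn0; apply: OinvM; first by rewrite addn0; exact: Oinv_exp.
apply: OinvMl => //; rewrite -(muln0 k); apply: OinvX; exact: Oinv_1Dinv.
Qed.

(** The leading terms of the Euler--Maclaurin expansions, checked by telescoping. *)
Lemma zeta_tail2 :
  Oinv 5 (fun n => zeta_tail 2 n - (n%:R^-1 + n%:R^-1 ^+ 2 / 2 + n%:R^-1 ^+ 3 / 6)).
Proof.
apply: zeta_tail_approx => //.
  apply: Oinv_ext (OinvMl (Oinv_horner (1 + 2^-1 *: 'X + 6^-1 *: 'X^2)) (Oinv_inv R)).
  by move=> n; rewrite !hornerE/=; ring.
apply: (@Oinv_succ_rational 6 (fun=> - 6^-1) 3); first exact: Oinv_cst.
move=> n n0; rewrite (succ_inv n0); have : 0 <= n%:R^-1 :> R by rewrite invr_ge0.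
by move: (n%:R^-1) => y y0; field; rewrite gt_eqF//; lra.
Qed.

Lemma zeta_tail3 :
  Oinv 4 (fun n => zeta_tail 3 n - (n%:R^-1 ^+ 2 / 2 + n%:R^-1 ^+ 3 / 2)).
Proof.
apply: zeta_tail_approx => //.
  apply: Oinv_ext (OinvMl (Oinv_horner (2^-1 *: 'X + 2^-1 *: 'X^2)) (Oinv_inv R)).
  by move=> n; rewrite !hornerE/=; ring.
apply: (@Oinv_succ_rational 5 (fun n => (1 + 2^-1 *: 'X).[n%:R^-1]) 3).
  exact: Oinv_horner.
move=> n n0; rewrite !hornerE/= (succ_inv n0).
have : 0 <= n%:R^-1 :> R by rewrite invr_ge0.
by move: (n%:R^-1) => y y0; field; rewrite gt_eqF//; lra.
Qed.

Lemma zeta_tail4 : Oinv 4 (fun n => zeta_tail 4 n - n%:R^-1 ^+ 3 / 3).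
Proof.
apply: zeta_tail_approx => //.
  apply: Oinv_ext (OinvMl (Oinv_horner (3^-1 *: 'X^2)) (Oinv_inv R)).
  by move=> n; rewrite !hornerE/=; ring.
apply: (@Oinv_succ_rational 5 (fun n => (2%:P + (8 / 3) *: 'X + 'X^2).[n%:R^-1]) 3).
  exact: Oinv_horner.
move=> n n0; rewrite !hornerE/= (succ_inv n0).
have : 0 <= n%:R^-1 :> R by rewrite invr_ge0.
by move: (n%:R^-1) => y y0; field; rewrite gt_eqF//; lra.
Qed.

End ZetaTails.

(** * Strings of digits and their moments *)

Section Digits.
Variables b d : nat.
Hypothesis b_gt1 : (1 < b)%N.
Hypothesis d_gt0 : (0 < d)%N.
Hypothesis d_ltb : (d < b)%N.

Lemma digits_rec_fuel k k' m : (m <= k)%N -> (m <= k')%N ->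
  digits_rec k b m = digits_rec k' b m.
Proof.
elim: k k' m => [|k IHk] [|k'] m //=.
- by rewrite leqn0 => /eqP ->.
- by move=> _; rewrite leqn0 => /eqP ->.
case: eqVneq => //; rewrite -lt0n => m0 mk mk'; congr (_ :: _).
by apply: IHk; rewrite -ltnS (leq_trans (ltn_Pdiv b_gt1 m0)).
Qed.

Lemma digits_cons m : (0 < m)%N -> digits b m = (m %% b)%N :: digits b (m %/ b)%N.
Proof.
case: m => // m _; rewrite /digits [LHS]/=; congr (_ :: _).
by apply: digits_rec_fuel => //; rewrite -ltnS ltn_Pdiv.
Qed.

(** Number of digits [d] among the [l] least significant digits of [n], leading
    zeros included. *)
Fixpoint pad_count (l n : nat) : nat :=
  if l is l'.+1 then ((n %% b == d) + pad_count l' (n %/ b))%N else 0%N.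

Lemma count_digits_pad l A n : (0 < A)%N -> (n < b ^ l)%N ->
  count_mem d (digits b (A * b ^ l + n)) =
  (count_mem d (digits b A) + pad_count l n)%N.
Proof.
have b_gt0 : (0 < b)%N by exact: ltnW.
move=> A0; elim: l n => [|l IHl] n.
  by rewrite expn0 ltnS leqn0 => /eqP ->; rewrite muln1 !addn0.
rewrite expnSr => nb.
rewrite digits_cons ?addn_gt0 ?muln_gt0 ?A0 ?expn_gt0 ?b_gt0//=.
rewrite mulnA modnMDl divnMDl// IHl; last by rewrite ltn_divLR.
by rewrite addnCA.
Qed.

Lemma pad_count_lead l c n : (c < b)%N -> (n < b ^ l)%N ->
  pad_count l.+1 (c * b ^ l + n) = ((c == d) + pad_count l n)%N.
Proof.
have b_gt0 : (0 < b)%N by exact: ltnW.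
move=> cb; elim: l n => [|l IHl] n.
  by rewrite expn0 ltnS leqn0 => /eqP ->; rewrite muln1 /= !addn0 modn_small.
rewrite expnSr => nb; rewrite [LHS]/= mulnA modnMDl divnMDl//.
have := IHl (n %/ b)%N; rewrite ltn_divLR// => /(_ nb) /= ->.
by rewrite addnCA.
Qed.

Lemma count_digits_lt m : (0 < m)%N -> (m < b)%N ->
  count_mem d (digits b m) = (m == d).
Proof. by move=> m0 mb; rewrite digits_cons// modn_small// divn_small//= addn0. Qed.

Lemma count_digits2 a c : (0 < a)%N -> (a < b)%N -> (c < b)%N ->
  count_mem d (digits b (a * b + c)) = ((a == d) + (c == d))%N.
Proof.
move=> a0 ab cb; have := @count_digits_pad 1 a c a0; rewrite expn1 => /(_ cb) ->.
by rewrite count_digits_lt//= modn_small// addn0.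
Qed.

Section Sums.
Variable R : realType.
Implicit Types (F : nat -> R).

Lemma sum_blocks (p r q : nat) (P : pred nat) F : (p <= r)%N ->
  \sum_((p * q)%N <= m < (r * q)%N | P m) F m =
  \sum_(p <= A < r) \sum_(0 <= n < q | P (A * q + n)%N) F (A * q + n)%N.
Proof.
elim: r => [|r IHr]; first by rewrite leqn0 => /eqP ->; rewrite !big_geq.
rewrite leq_eqVlt => /predU1P[->|]; first by rewrite !big_geq.
rewrite ltnS => pr; rewrite big_nat_recr//= -IHr//.
rewrite mulSn addnC (@big_cat_nat _ _ _ (r * q)%N)//= ?leq_mul// ?leq_addr//.
congr (_ + _); rewrite -{1}[(r * q)%N]add0n big_addn addKn.
by under [RHS]eq_bigl do rewrite addnC; under [RHS]eq_bigr do rewrite addnC.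
Qed.

(** Splitting off the leading one of l + 1 digits. *)
Lemma sum_pad_count l k F :
  \sum_(0 <= n < (b ^ l.+1)%N | pad_count l.+1 n == k) F n =
  \sum_(0 <= c < b | c != d)
     \sum_(0 <= n < (b ^ l)%N | pad_count l n == k) F (c * b ^ l + n)%N
  + (if k is k'.+1 then
       \sum_(0 <= n < (b ^ l)%N | pad_count l n == k') F (d * b ^ l + n)%N else 0).
Proof.
rewrite -{1}(mul0n (b ^ l)%N) expnS sum_blocks//.
rewrite (bigID (fun c => c != d))/=; congr (_ + _).
  apply: congr_big_nat => // c /andP[cd /andP[_ cb]].
  apply: congr_big_nat => // n; rewrite leq0n /= => nb.
  by rewrite -/(pad_count l.+1 _) pad_count_lead// (negbTE cd).
under eq_bigl do rewrite negbK.
rewrite big_nat1_eq leq0n d_ltb /=.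
case: k => [|k].
  rewrite big_nat_cond big_pred0// => n; apply/negbTE.
  rewrite -/(pad_count l.+1 _); apply/negP => /andP[/andP[_ nb]].
  by rewrite pad_count_lead// eqxx.
apply: congr_big_nat => // n; rewrite leq0n /= => nb.
by rewrite -/(pad_count l.+1 _) pad_count_lead// eqxx add1n eqSS.
Qed.

(** The moment of order j of the measure mu_k, which has a mass b^-l at n/b^l for
    each string of l digits, of value n, with exactly k digits equal to d; only
    the strings of fewer than L digits are kept.  The empty string is included:
    it is the atom of mu_0 at 0. *)
Definition partial_moment (k j L : nat) : R :=
  \sum_(l < L) \sum_(0 <= n < (b ^ l)%N | pad_count l n == k)
    (b ^ l)%:R^-1 * (n%:R / (b ^ l)%:R) ^+ j.

Definition moment (k j : nat) : R := limn (partial_moment k j).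

Definition digit_power_sum (j : nat) : R := \sum_(0 <= c < b | c != d) c%:R ^+ j.

Let bR_gt0 : 0 < b%:R :> R. Proof. by rewrite ltr0n ltnW. Qed.
Let bR_neq0 : b%:R != 0 :> R. Proof. by rewrite gt_eqF. Qed.

Lemma partial_moment_rec k j L :
  partial_moment k j L.+1 = (if k == 0%N then 0 ^+ j else 0) +
    b%:R^-1 ^+ j.+1 * \sum_(i < j.+1) 'C(j, i)%:R *
      (digit_power_sum (j - i) * partial_moment k i L +
       (if k is k'.+1 then d%:R ^+ (j - i) * partial_moment k' i L else 0)).
Proof.
rewrite /partial_moment big_ord_recl; congr (_ + _).
  rewrite expn0 big_mkcond big_nat1/= eq_sym.
  by case: eqP => // _; rewrite invr1 mul1r mul0r.
have bl l : (b ^ l)%:R != 0 :> R by rewrite natrX expf_neq0.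
have lead c l n : (b ^ l.+1)%:R^-1 * ((c * b ^ l + n)%:R / (b ^ l.+1)%:R) ^+ j =
    \sum_(i < j.+1) b%:R^-1 ^+ j.+1 * ('C(j, i)%:R * (c%:R ^+ (j - i) *
       ((b ^ l)%:R^-1 * (n%:R / (b ^ l)%:R) ^+ i))) :> R.
  have -> : (c * b ^ l + n)%:R / (b ^ l.+1)%:R = b%:R^-1 * (c%:R + n%:R / (b ^ l)%:R) :> R.
    by rewrite natrD natrM expnS natrM; field; rewrite bR_neq0 bl.
  rewrite exprMn exprDn expnS natrM invfM -mulrA mulr_sumr mulr_sumr mulr_sumr.
  apply: eq_bigr => i _; rewrite -mulr_natl exprS.
  by ring.
rewrite mulr_sumr.
under eq_bigr => l _ do rewrite sum_pad_count.
have E c k' : \sum_(l < L) \sum_(0 <= n < (b ^ l)%N | pad_count l n == k')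
      (b ^ l.+1)%:R^-1 * ((c * b ^ l + n)%:R / (b ^ l.+1)%:R) ^+ j =
    \sum_(i < j.+1) b%:R^-1 ^+ j.+1 * ('C(j, i)%:R * (c%:R ^+ (j - i) *
       partial_moment k' i L)) :> R.
  under eq_bigr => l _ do under eq_bigr => n _ do rewrite lead.
  under eq_bigr => l _ do rewrite exchange_big/=.
  rewrite exchange_big/=; apply: eq_bigr => i _.
  rewrite /partial_moment !mulr_sumr; apply: eq_bigr => l _.
  by rewrite !mulr_sumr.
rewrite big_split/= exchange_big/=.
under eq_bigr => c _ do rewrite E.
rewrite exchange_big/=.
have -> : \sum_(l < L) (if k is k'.+1 then
      \sum_(0 <= n < (b ^ l)%N | pad_count l n == k')
      (b ^ l.+1)%:R^-1 * ((d * b ^ l + n)%:R / (b ^ l.+1)%:R) ^+ j else 0) =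
    \sum_(i < j.+1) b%:R^-1 ^+ j.+1 * ('C(j, i)%:R * (if k is k'.+1 then
       (d%:R ^+ (j - i) * partial_moment k' i L) else 0)) :> R.
  case: k => [|k]; last exact: E.
  rewrite !big1// => i _; by rewrite !mulr0.
rewrite -big_split/=; apply: eq_bigr => i _.
rewrite -!mulr_sumr -!mulrDr; congr (_ * (_ * (_ + _))).
by rewrite /digit_power_sum mulr_suml.
Qed.

Lemma digit_power_sum0 : digit_power_sum 0 = b%:R - 1.
Proof.
rewrite /digit_power_sum; under eq_bigr do rewrite expr0.
have : \sum_(0 <= c < b) (1 : R) = b%:R.
  by rewrite big_const_nat subn0 iter_addr_0.
rewrite (bigID (fun c => c != d))/=.
under [X in _ + X]eq_bigl do rewrite negbK.
by rewrite big_nat1_eq leq0n d_ltb /= => <-; rewrite addrK.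
Qed.

Lemma partial_moment_ge0 k j L : 0 <= partial_moment k j L.
Proof.
apply: sumr_ge0 => l _; apply: sumr_ge0 => n _.
by rewrite mulr_ge0 ?invr_ge0// exprn_ge0// divr_ge0.
Qed.

Lemma partial_moment_mass_le k L : partial_moment k 0 L <= b%:R.
Proof.
elim: L k => [|L IHL] k; first by rewrite /partial_moment big_ord0 ltW.
rewrite partial_moment_rec big_ord_recl big_ord0 addr0 subnn bin0 mul1r expr1.
rewrite digit_power_sum0 !expr0.
have b1 : 0 <= b%:R - 1 :> R by rewrite subr_ge0 ler1n ltnW.
rewrite -(ler_pM2l bR_gt0) mulrDr mulVKf//.
have := ler_wpM2l b1 (IHL k).
case: k => [|k] /=; first by nra.
by have := IHL k; nra.
Qed.

Lemma frac_le1 l n : (n < b ^ l)%N -> n%:R / (b ^ l)%:R <= 1 :> R.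
Proof.
move=> nb; rewrite ler_pdivrMr ?mul1r ?ler_nat ?(ltnW nb)// ltr0n.
by apply: leq_ltn_trans nb.
Qed.

Lemma partial_moment_le k j L : partial_moment k j L <= b%:R.
Proof.
apply: le_trans (partial_moment_mass_le k L).
apply: ler_sum => l _; rewrite big_nat_cond [leRHS]big_nat_cond.
apply: ler_sum => n /andP[/andP[_ nb] _].
rewrite expr0 ler_wpM2l ?invr_ge0// exprn_ile1// ?frac_le1//.
Qed.

Lemma cvg_partial_moment k j : partial_moment k j L @[L --> \oo] --> moment k j.
Proof.
apply: nondecreasing_is_cvgn.
  apply/nondecreasing_seqP => L; rewrite [leRHS]/partial_moment big_ord_recr/=.
  rewrite lerDl; apply: sumr_ge0 => n _.
  by rewrite mulr_ge0 ?invr_ge0// exprn_ge0// divr_ge0.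
by exists b%:R => _ [L _ <-]; exact: partial_moment_le.
Qed.

(** The self-similarity of mu_k, obtained by splitting off the leading digit. *)
Lemma moment_rec k j :
  moment k j = (if k == 0%N then 0 ^+ j else 0) +
    b%:R^-1 ^+ j.+1 * \sum_(i < j.+1) 'C(j, i)%:R *
      (digit_power_sum (j - i) * moment k i +
       (if k is k'.+1 then d%:R ^+ (j - i) * moment k' i else 0)).
Proof.
have c1 : partial_moment k j L.+1 @[L --> \oo] --> moment k j.
  by have := @cvg_partial_moment k j; rewrite -cvg_shiftS.
apply: (cvg_unique _ c1); first exact: Rhausdorff.
rewrite (funext (fun L => partial_moment_rec k j L)).
apply: cvgD; first exact: cvg_cst.
apply: cvgMr; apply: cvg_sumr => i _; apply: cvgMr.
apply: cvgD; first by apply: cvgMr; exact: cvg_partial_moment.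
by case: k {c1} => [|k]; [exact: cvg_cst | apply: cvgMr; exact: cvg_partial_moment].
Qed.

Lemma moment_mass k : moment k 0 = b%:R.
Proof.
elim: k => [|k IHk]; have := moment_rec _ 0;
  [move=> /(_ 0%N)|move=> /(_ k.+1)];
  rewrite big_ord_recl big_ord0 addr0 subnn bin0 mul1r expr1 digit_power_sum0 expr0.
  move/(congr1 (fun x => b%:R * x)); rewrite /= addr0 mulrDr mulVKf//; lra.
move/(congr1 (fun x => b%:R * x)); rewrite /= add0r mulVKf// mul1r IHk; lra.
Qed.

Lemma geom_alternating_le (t : R) J : 0 <= t ->
  `|(1 + t)^-1 - \sum_(j < J) (- t) ^+ j| <= t ^+ J.
Proof.
move=> t0; have t1 : 1 + t != 0 by rewrite gt_eqF//; lra.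
have -> : (1 + t)^-1 - \sum_(j < J) (- t) ^+ j = (- t) ^+ J / (1 + t).
  have := subrX1 (- t) J.
  move: (\sum_(j < J) _) => S e; apply: (mulIf t1); rewrite mulrBl mulVf// mulfVK//.
  by rewrite -[(- t) ^+ J](subrK 1) e; ring.
have w0 : 0 <= (1 + t)^-1 by rewrite invr_ge0; lra.
rewrite normrM normrX normrN (ger0_norm t0) (ger0_norm w0).
by rewrite ler_piMr ?exprn_ge0// invf_le1; lra.
Qed.

(** Geometric expansion of 1/m over the numbers m beginning with A. *)
Lemma partial_block_approx k A J L : (0 < A)%N ->
  `|\sum_(l < L) \sum_(0 <= n < (b ^ l)%N | pad_count l n == k) (A * b ^ l + n)%:R^-1
    - \sum_(j < J) (-1) ^+ j * A%:R^-1 ^+ j.+1 * partial_moment k j L|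
  <= A%:R^-1 ^+ J.+1 * partial_moment k 0 L.
Proof.
move=> A0; have AR : 0 < A%:R :> R by rewrite ltr0n.
rewrite /partial_moment.
under [X in _ - X]eq_bigr => j _ do rewrite mulr_sumr.
rewrite exchange_big/= -sumrB mulr_sumr (le_trans (ler_norm_sum _ _ _))//.
apply: ler_sum => l _.
under [X in _ - X]eq_bigr => j _ do rewrite mulr_sumr.
rewrite exchange_big/= -sumrB mulr_sumr (le_trans (ler_norm_sum _ _ _))//.
rewrite big_nat_cond [leRHS]big_nat_cond.
apply: ler_sum => n /andP[/andP[_ nb] _].
have bl : (b ^ l)%:R != 0 :> R by rewrite natrX expf_neq0.
have bl0 : 0 <= (b ^ l)%:R^-1 :> R by rewrite invr_ge0.
have x1 := frac_le1 nb.
have x0 : 0 <= n%:R / (b ^ l)%:R :> R by rewrite divr_ge0.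
have [x xE] : exists x : R, x = n%:R / (b ^ l)%:R by eexists.
rewrite -xE in x0 x1 *.
have t0 : 0 <= x / A%:R by rewrite divr_ge0.
have -> : (A * b ^ l + n)%:R^-1 = (b ^ l)%:R^-1 * A%:R^-1 * (1 + x / A%:R)^-1 :> R.
  rewrite -!invfM; congr (_^-1); rewrite xE natrD natrM.
  by field; rewrite bl gt_eqF.
have -> : \sum_(j < J) (-1) ^+ j * A%:R^-1 ^+ j.+1 * ((b ^ l)%:R^-1 * x ^+ j) =
   (b ^ l)%:R^-1 * A%:R^-1 * \sum_(j < J) (- (x / A%:R)) ^+ j.
  rewrite mulr_sumr; apply: eq_bigr => j _.
  by rewrite exprS [(- (x / _)) ^+ j]exprNn exprMn; ring.
rewrite -mulrBr normrM ger0_norm ?mulr_ge0 ?invr_ge0//.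
rewrite expr0 mulr1 [leRHS]mulrC exprS mulrA ler_wpM2l ?mulr_ge0 ?invr_ge0//.
apply: le_trans (geom_alternating_le J t0) _.
by rewrite exprMn ler_piMl ?exprn_ge0 ?invr_ge0// exprn_ile1.
Qed.

Lemma sum_one_digit :
  \sum_(1 <= m < b | count_mem d (digits b m) == 1%N) m%:R^-1 = d%:R^-1 :> R.
Proof.
have H m : (1 <= m < b)%N -> (count_mem d (digits b m) == 1%N) = (m == d).
  by move=> /andP[m0 mb]; rewrite count_digits_lt//; case: (m == d).
transitivity (\sum_(1 <= m < b | m == d) m%:R^-1 : R); first exact: congr_big_nat.
by rewrite big_nat1_eq d_gt0 d_ltb.
Qed.

Lemma irwin_partial L :
  \sum_(1 <= m < (b ^ L.+1)%N | count_mem d (digits b m) == 1%N) m%:R^-1 =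
  d%:R^-1 + \sum_(b <= A < (b ^ 2)%N) \sum_(l < L)
     \sum_(0 <= n < (b ^ l)%N | (count_mem d (digits b A) + pad_count l n == 1)%N)
       (A * b ^ l + n)%:R^-1 :> R.
Proof.
have b_gt0 : (0 < b)%N by exact: ltnW.
rewrite exchange_big/=; elim: L => [|L IHL].
  by rewrite big_ord0 addr0 expn1 sum_one_digit.
rewrite big_ord_recr/= addrA -IHL.
rewrite (@big_cat_nat _ _ _ (b ^ L.+1)%N)//= ?expn_gt0 ?b_gt0// ?leq_exp2l//.
congr (_ + _).
have -> : (b ^ L.+2 = b ^ 2 * b ^ L)%N by rewrite -expnD.
rewrite expnS sum_blocks ?leq_exp2l//; last by rewrite -{1}(expn1 b) leq_exp2l.
apply: eq_big_nat => A /andP[bA _].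
apply: congr_big_nat => // n; rewrite leq0n /= => nb.
by rewrite count_digits_pad// (leq_trans b_gt0).
Qed.

(** Selects, among quantities u k indexed by the number k of digits d in a tail,
    the one for which a number beginning with A has exactly one digit d. *)
Definition select_tail (A : nat) (u : nat -> R) : R :=
  match count_mem d (digits b A) with
  | 0%N => u 1%N
  | 1%N => u 0%N
  | _ => 0
  end.

Lemma irwin_partial_approx J L :
  `|\sum_(1 <= m < (b ^ L.+1)%N | count_mem d (digits b m) == 1%N) m%:R^-1
    - (d%:R^-1 + \sum_(b <= A < (b ^ 2)%N) \sum_(j < J)
         (-1) ^+ j * A%:R^-1 ^+ j.+1 * select_tail A (fun k => partial_moment k j L))|
  <= b%:R ^+ 3 * b%:R^-1 ^+ J.+1.
Proof.
rewrite /select_tail.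
have b_gt0 : (0 < b)%N by exact: ltnW.
rewrite irwin_partial opprD addrACA subrr add0r -sumrB.
rewrite (le_trans (ler_norm_sum _ _ _))//.
apply: (@le_trans _ _ (\sum_(b <= A < (b ^ 2)%N) b%:R^-1 ^+ J.+1 * b%:R)); last first.
  rewrite big_const_nat iter_addr_0 -[leLHS]mulr_natr natrB ?natrX; last first.
    by rewrite -{1}(expn1 b) leq_exp2l.
  have : 0 <= b%:R^-1 ^+ J.+1 :> R by rewrite exprn_ge0// invr_ge0.
  by move: (b%:R^-1 ^+ J.+1) bR_gt0 => y b0 y0; nra.
rewrite big_nat [leRHS]big_nat; apply: ler_sum => A /andP[bA _].
have A0 : (0 < A)%N by apply: leq_trans bA.
have AR : A%:R^-1 ^+ J.+1 <= b%:R^-1 ^+ J.+1 :> R.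
  rewrite lerXn2r ?nnegrE ?invr_ge0// lef_pV2 ?posrE ?ltr0n//.
  by rewrite ler_nat.
have AR0 : 0 <= A%:R^-1 ^+ J.+1 :> R by rewrite exprn_ge0// invr_ge0.
have blk k : A%:R^-1 ^+ J.+1 * partial_moment k 0 L <= b%:R^-1 ^+ J.+1 * b%:R.
  by rewrite ler_pM// ?partial_moment_ge0// partial_moment_le.
case: (count_mem d (digits b A)) => [|[|q]].
- by apply: le_trans (blk 1%N); exact: partial_block_approx.
- by apply: le_trans (blk 0%N); exact: partial_block_approx.
- rewrite !big1 ?subrr ?normr0 ?mulr_ge0 ?exprn_ge0 ?invr_ge0//.
  + by move=> j _; rewrite mulr0.
  + by move=> l _; rewrite big_pred0// => n.
Qed.

Lemma irwin_cvg :
  \sum_(1 <= m < (b ^ L.+1)%N | count_mem d (digits b m) == 1%N) m%:R^-1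
    @[L --> \oo] --> irwin R b d 1.
Proof.
pose S n : R := \sum_(1 <= m < n | count_mem d (digits b m) == 1%N) m%:R^-1.
have Snd : nondecreasing_seq S.
  apply/nondecreasing_seqP => -[|n]; first by rewrite /S !big_geq.
  rewrite /S [leRHS]big_mkcond/= big_nat_recr//= -big_mkcond/= lerDl.
  by case: ifP.
have pow_ge n : (n <= b ^ n.+1)%N.
  by apply: ltnW; rewrite (ltn_trans (ltn_expl n b_gt1))// ltn_exp2l.
have SS : S n @[n --> \oo] --> irwin R b d 1.
  apply: nondecreasing_is_cvgn => //.
  exists (d%:R^-1 + b%:R ^+ 3 * b%:R^-1 ^+ 1) => _ [n _ <-].
  apply: le_trans (Snd _ _ (pow_ge n)) _.
  have := irwin_partial_approx 0 n; rewrite [X in d%:R^-1 + X]big1.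
    by move=> /(le_trans (ler_norm _)); rewrite -/(S _); lra.
  by move=> A _; rewrite big_ord0.
apply: (cvg_comp (fun L => (b ^ L.+1)%N) S _ SS).
move=> P [N _ NP]; exists N => // n /= Nn; apply: NP => /=.
exact: leq_trans Nn (pow_ge n).
Qed.

Lemma irwin_approx_prefix J :
  `|irwin R b d 1 - (d%:R^-1 + \sum_(b <= A < (b ^ 2)%N)
      \sum_(j < J) (-1) ^+ j * A%:R^-1 ^+ j.+1 * select_tail A (fun k => moment k j))|
  <= b%:R ^+ 3 * b%:R^-1 ^+ J.+1.
Proof.
apply: (cvg_dist_le irwin_cvg (v := fun L => d%:R^-1 + \sum_(b <= A < (b ^ 2)%N)
  \sum_(j < J) (-1) ^+ j * A%:R^-1 ^+ j.+1 *
    select_tail A (fun k => partial_moment k j L))) => [|L].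
  apply: cvgD; first exact: cvg_cst.
  apply: cvg_sumr => A _; apply: cvg_sumr => j _; apply: cvgMr.
  rewrite /select_tail; case: (count_mem _ _) => [|[|q]];
    [exact: cvg_partial_moment|exact: cvg_partial_moment|exact: cvg_cst].
exact: irwin_partial_approx.
Qed.

(** The sum of A^-s over the two-digit A with exactly k digits d. *)
Definition prefix_sum (k s : nat) : R :=
  \sum_(b <= A < (b ^ 2)%N | count_mem d (digits b A) == k) (A%:R ^+ s)^-1.

(** The truncation error: each of the fewer than b^2 prefixes A >= b contributes at
    most A^-(J+1) times the mass b. *)
Lemma irwin_approx J :
  `|irwin R b d 1 - (d%:R^-1 + \sum_(j < J) (-1) ^+ j *
      (moment 1 j * prefix_sum 0 j.+1 + moment 0 j * prefix_sum 1 j.+1))|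
  <= b%:R ^+ 3 * b%:R^-1 ^+ J.+1.
Proof.
have := irwin_approx_prefix J; congr (`|_ - (_ + _)| <= _).
rewrite exchange_big/=; apply: eq_bigr => j _.
rewrite /prefix_sum [in RHS]big_mkcond [X in _ * (_ + _ * X)]big_mkcond.
rewrite !mulr_sumr -big_split/= mulr_sumr; apply: eq_bigr => A _.
rewrite /select_tail exprVn.
by case: (count_mem _ _) => [|[|q]] /=; ring.
Qed.

(** The sums over the two-digit numbers with leading digit, resp. unit digit, d. *)
Definition lead_sum s : R := \sum_(0 <= c < b) ((d * b + c)%:R ^+ s)^-1.
Definition unit_sum s : R := \sum_(1 <= a < b) ((a * b + d)%:R ^+ s)^-1.

Lemma sum_neq p q (F : nat -> R) : (p <= d < q)%N ->
  \sum_(p <= c < q | c != d) F c = \sum_(p <= c < q) F c - F d.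
Proof.
move=> pdq; rewrite [X in X - _](bigID (fun c => c != d))/=.
under [X in _ + X - _]eq_bigl do rewrite negbK.
by rewrite big_nat1_eq pdq addrK.
Qed.

Lemma prefix_sum_digits k s : prefix_sum k s =
  \sum_(1 <= a < b) \sum_(0 <= c < b | ((a == d) + (c == d) == k)%N)
    ((a * b + c)%:R ^+ s)^-1.
Proof.
have b_gt0 : (0 < b)%N by exact: ltnW.
rewrite /prefix_sum -{1}(mul1n b) -mulnn sum_blocks//.
apply: eq_big_nat => a /andP[a0 ab].
apply: congr_big_nat => // c; rewrite leq0n /= => cb.
by rewrite count_digits2.
Qed.

Lemma prefix_sum1 s :
  prefix_sum 1 s = lead_sum s + unit_sum s - 2 * ((d * b + d)%:R ^+ s)^-1.
Proof.
rewrite prefix_sum_digits (bigID (fun a => a != d))/=.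
under [X in _ + X]eq_bigl do rewrite negbK.
rewrite big_nat1_eq d_gt0 d_ltb/= eqxx.
have -> : \sum_(0 <= c < b | (true + (c == d) == 1)%N) ((d * b + c)%:R ^+ s)^-1 =
    \sum_(0 <= c < b | c != d) ((d * b + c)%:R ^+ s)^-1 :> R.
  by apply: eq_bigl => c; case: (c == d).
rewrite [X in _ + X]sum_neq ?d_ltb// -/(lead_sum s).
under eq_bigr => a ad.
  rewrite (negbTE ad).
  under eq_bigl do rewrite add0n eqb1.
  rewrite big_nat1_eq leq0n d_ltb/=.
  over.
rewrite sum_neq ?d_gt0// -/(unit_sum s); ring.
Qed.

Lemma prefix_sum0 s :
  prefix_sum 0 s = \sum_(b <= A < (b ^ 2)%N) (A%:R ^+ s)^-1
     - lead_sum s - unit_sum s + ((d * b + d)%:R ^+ s)^-1.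
Proof.
rewrite prefix_sum_digits (bigID (fun a => a != d))/=.
under [X in _ + X]eq_bigl do rewrite negbK.
rewrite big_nat1_eq d_gt0 d_ltb/= eqxx.
rewrite [X in _ + X]big_pred0//.
under eq_bigr => a ad.
  rewrite (negbTE ad).
  under eq_bigl do rewrite add0n eqb0.
  rewrite sum_neq ?d_ltb//.
  over.
rewrite sum_neq ?d_gt0// sumrB.
have -> : \sum_(b <= A < (b ^ 2)%N) (A%:R ^+ s)^-1 =
    \sum_(1 <= a < b) \sum_(0 <= c < b) ((a * b + c)%:R ^+ s)^-1 :> R.
  by rewrite -{1}(mul1n b) -mulnn sum_blocks 1?ltnW.
by rewrite -/(lead_sum s) -/(unit_sum s); ring.
Qed.

End Sums.
End Digits.

(** * Deviations of the moments *)

Section PowerSums.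
Local Arguments binomial : simpl never.
Variable R : realType.
Implicit Types (b k m : nat).

(** The sum of the k-th powers of the digits, scaled by b^-(k+1) so as to be a
    polynomial in 1/b (Faulhaber). *)
Definition power_sum k b : R := b%:R^-1 ^+ k.+1 * \sum_(0 <= c < b) c%:R ^+ k.

Lemma power_sum_rec m b : (0 < b)%N ->
  \sum_(i < m.+1) 'C(m.+1, i)%:R * (b%:R^-1 ^+ (m - i) * power_sum i b) = 1.
Proof.
move=> b0; have bR : b%:R != 0 :> R by rewrite pnatr_eq0 -lt0n.
have E : \sum_(0 <= c < b) (c.+1%:R ^+ m.+1 - c%:R ^+ m.+1) = b%:R ^+ m.+1 :> R.
  by rewrite telescope_sumr// expr0n subr0.
have E2 : \sum_(i < m.+1) 'C(m.+1, i)%:R * \sum_(0 <= c < b) c%:R ^+ i = b%:R ^+ m.+1 :> R.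
  rewrite -E; under eq_bigr do rewrite mulr_sumr.
  rewrite exchange_big/=; apply: eq_bigr => c _.
  rewrite -natr1 [_ + 1]addrC exprDn [in RHS]big_ord_recr/= binn subnn expr0 mul1r mulr1n.
  rewrite addrK; apply: eq_bigr => i _.
  by rewrite expr1n mul1r mulr_natl.
have yb : b%:R^-1 ^+ m.+1 * b%:R ^+ m.+1 = 1 :> R by rewrite -exprMn mulVf// expr1n.
rewrite -[RHS]yb -E2 mulr_sumr; apply: eq_bigr => i _.
rewrite /power_sum [_ ^+ (m - i) * _]mulrA -exprD.
have -> : (m - i + i.+1 = m.+1)%N by have := ltn_ord i; lia.
by ring.
Qed.

(** This says that Lebesgue measure satisfies the self-similarity relation for all
    digits. *)
Lemma power_sum_binom m b : (0 < b)%N ->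
  \sum_(i < m.+1) 'C(m, i)%:R * (b%:R^-1 ^+ i * power_sum (m - i) b) / i.+1%:R
  = m.+1%:R^-1.
Proof.
move=> /(power_sum_rec m) E.
have m0 : m.+1%:R != 0 :> R by rewrite pnatr_eq0.
apply: (mulfI m0); rewrite mulfV// -[RHS]E mulr_sumr [RHS](reindex_inj rev_ord_inj)/=.
apply: eq_bigr => i _; rewrite subSS.
have im : (i <= m)%N by rewrite -ltnS.
rewrite subKn// -[in RHS]bin_sub; last by lia.
have -> : (m.+1 - (m - i) = i.+1)%N by lia.
have i0 : i.+1%:R != 0 :> R by rewrite pnatr_eq0.
apply: (mulIf i0); rewrite -[LHS]mulrA mulfVK//.
have /(congr1 (fun n => n%:R : R)) := mul_bin_diag m.+1 i; rewrite !natrM /= => E2.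
transitivity (m.+1%:R * 'C(m, i)%:R * (b%:R^-1 ^+ i * power_sum (m - i) b)).
  by ring.
by rewrite E2; ring.
Qed.

Lemma expandable_power_sum k : expandable (power_sum k).
Proof.
elim/ltn_ind: k => k IHk.
have k0 : k.+1%:R != 0 :> R by rewrite pnatr_eq0.
apply: (@expandable_near _ (fun b => k.+1%:R^-1 *
  (1 - \sum_(i < k) 'C(k.+1, i)%:R * (b%:R^-1 ^+ (k - i) * power_sum i b)))).
  exists 1%N => // b b0; apply: (mulfI k0); rewrite mulVKf//.
  rewrite -[X in X - _](power_sum_rec k b0) big_ord_recr/=.
  by rewrite subnn expr0 mul1r binSn [X in X - _]addrC addrK.
apply: expandableZ; apply: expandableB; first exact: expandable_cst.
apply: expandable_sum => i _; apply: expandableZ; apply: expandableM.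
  by apply: expandableX; exact: expandable_inv.
exact: IHk.
Qed.

Lemma power_sum0 b : (0 < b)%N -> power_sum 0 b = 1.
Proof. by move=> b0; have := power_sum_rec 0 b0; rewrite big_ord1 expr0 !mul1r. Qed.

Lemma power_sum1 b : (0 < b)%N -> power_sum 1 b = 1 / 2 - b%:R^-1 / 2.
Proof.
move=> b0; have := power_sum_rec 1 b0.
rewrite !big_ord_recl big_ord0/= power_sum0//= ?bin0 /bump/= bin1 expr0; lra.
Qed.

Lemma power_sum2 b : (0 < b)%N ->
  power_sum 2 b = 1 / 3 + b%:R^-1 * (b%:R^-1 / 6 - 1 / 2).
Proof.
move=> b0; have := power_sum_rec 2 b0.
rewrite !big_ord_recl big_ord0/= power_sum0//= power_sum1// /bump/= bin0 bin1 expr0.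
by rewrite (_ : 'C(3, 2) = 3%N)//=; lra.
Qed.

End PowerSums.

Section Moments.
Local Arguments binomial : simpl never.
Variables (R : realType) (d : nat).
Hypothesis d_gt0 : (0 < d)%N.
Implicit Types (b j k m N s : nat).

Lemma near_digit : \forall b \near \oo, (1 < b)%N /\ (d < b)%N.
Proof. by exists d.+1 => // b /= db; split=> //; apply: leq_ltn_trans db. Qed.

(** The scaled power sums over the digits other than d. *)
Definition sigma k b : R := power_sum R k b - b%:R^-1 ^+ k.+1 * d%:R ^+ k.

Lemma sigmaE k b : (d < b)%N ->
  b%:R^-1 ^+ k.+1 * digit_power_sum b d R k = sigma k b.
Proof. by move=> db; rewrite /digit_power_sum sum_neq ?db// mulrBr. Qed.

Lemma expandable_sigma k : expandable (sigma k).
Proof.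
apply: expandableB; first exact: expandable_power_sum.
apply: expandableM; last exact: expandable_cst.
by apply: expandableX; exact: expandable_inv.
Qed.

Lemma sigma0 b : (0 < b)%N -> sigma 0 b = 1 - b%:R^-1.
Proof. by move=> b0; rewrite /sigma power_sum0// expr0 mulr1 expr1. Qed.

(** Deviation of the moment of order j of mu_k from that of b times Lebesgue
    measure on [0, 1]. *)
Definition dev k j b : R := moment b d R k j - b%:R / j.+1%:R.

Lemma dev_mass k : \forall b \near \oo, dev k 0 b = 0.
Proof.
apply: filterS near_digit => b [b1 db].
by rewrite /dev moment_mass// invr1 mulr1 subrr.
Qed.

(** The factor that solves the recurrence of order m for its diagonal term. *)
Definition damp m b : R := (1 - (b%:R^-1 ^+ m - b%:R^-1 ^+ m.+1))^-1.

Lemma Oinv_damp_exponent m : (0 < m)%N ->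
  Oinv m (fun b => b%:R^-1 ^+ m - b%:R^-1 ^+ m.+1 : R).
Proof.
by move=> m0; apply: OinvB; [exact: Oinv_exp | apply: Oinv_le (Oinv_exp R m.+1)].
Qed.

Lemma expandable_damp m : (0 < m)%N -> expandable (damp m).
Proof.
move=> m0; apply: expandable_geom; first exact: Oinv_le (Oinv_damp_exponent m0).
by apply: expandableB; apply: expandableX; exact: expandable_inv.
Qed.

Lemma Oinv_damp m : (0 < m)%N -> Oinv 0 (damp m).
Proof. by move=> m0; apply: expandable_Oinv0; exact: expandable_damp. Qed.

Lemma damp_neq0 m b : (0 < m)%N -> (1 < b)%N ->
  1 - (b%:R^-1 ^+ m - b%:R^-1 ^+ m.+1) != 0 :> R.
Proof.
move=> m0 b1; have b0 : 0 < b%:R^-1 :> R by rewrite invr_gt0 ltr0n ltnW.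
have y1 : b%:R^-1 < 1 :> R by rewrite invf_lt1 ?ltr1n// ltr0n ltnW.
have : b%:R^-1 ^+ m <= b%:R^-1 ^+ 1 :> R by rewrite ler_wiXn2l ?ltW.
have : 0 <= b%:R^-1 ^+ m.+1 :> R by rewrite exprn_ge0// ltW.
by rewrite expr1 => y2 y3; rewrite gt_eqF//; lra.
Qed.

(** Subtracting the relation for Lebesgue measure from [moment_rec] leaves, as source
    term, the omitted digit d: it carries - b times Lebesgue measure if k = 0, and
    the deviations for k - 1 if k > 0. *)
Lemma dev_rec k m b : (0 < m)%N -> (1 < b)%N -> (d < b)%N ->
  dev k m b = damp m b *
    (\sum_(i < m) 'C(m, i)%:R * (b%:R^-1 ^+ i * sigma (m - i) b * dev k i b)
     + b%:R^-1 ^+ m.+1 * \sum_(i < m.+1) 'C(m, i)%:R * d%:R ^+ (m - i) *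
         (if k is k'.+1 then dev k' i b else - (b%:R / i.+1%:R))).
Proof.
move=> m0 b1 db; have b0 : (0 < b)%N by exact: ltnW.
have bR : b%:R != 0 :> R by rewrite pnatr_eq0 -lt0n.
have bin := power_sum_binom R m b0.
have rec : moment b d R k m = \sum_(i < m.+1) 'C(m, i)%:R *
   (b%:R^-1 ^+ i * sigma (m - i) b * moment b d R k i +
    b%:R^-1 ^+ m.+1 * (if k is k'.+1 then d%:R ^+ (m - i) * moment b d R k' i else 0)).
  rewrite {1}moment_rec// expr0n (gtn_eqF m0) if_same add0r mulr_sumr.
  apply: eq_bigr => i _; rewrite -sigmaE// [_ ^+ i * _]mulrA -exprD.
  have -> : (i + (m - i).+1 = m.+1)%N by have := ltn_ord i; lia.
  by case: (k) => [|k']; ring.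
have main : b%:R / m.+1%:R = \sum_(i < m.+1) 'C(m, i)%:R *
    (b%:R^-1 ^+ i * sigma (m - i) b * (b%:R / i.+1%:R) +
     b%:R^-1 ^+ m.+1 * (d%:R ^+ (m - i) * (b%:R / i.+1%:R))).
  rewrite -bin mulr_sumr; apply: eq_bigr => i _.
  have i0 : i.+1%:R != 0 :> R by rewrite pnatr_eq0.
  have -> : b%:R^-1 ^+ m.+1 = b%:R^-1 ^+ i * b%:R^-1 ^+ (m - i).+1 :> R.
    by rewrite -exprD; congr (_ ^+ _); have := ltn_ord i; lia.
  by rewrite /sigma; ring.
have E : dev k m b = \sum_(i < m) 'C(m, i)%:R * (b%:R^-1 ^+ i * sigma (m - i) b * dev k i b)
    + (b%:R^-1 ^+ m - b%:R^-1 ^+ m.+1) * dev k m b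
    + b%:R^-1 ^+ m.+1 * \sum_(i < m.+1) 'C(m, i)%:R * d%:R ^+ (m - i) *
         (if k is k'.+1 then dev k' i b else - (b%:R / i.+1%:R)).
  rewrite {1}/dev rec main -sumrB.
  transitivity (\sum_(i < m.+1) 'C(m, i)%:R * (b%:R^-1 ^+ i * sigma (m - i) b * dev k i b)
    + b%:R^-1 ^+ m.+1 * \sum_(i < m.+1) 'C(m, i)%:R * d%:R ^+ (m - i) *
         (if k is k'.+1 then dev k' i b else - (b%:R / i.+1%:R))).
    rewrite mulr_sumr -big_split/=; apply: eq_bigr => i _.
    by rewrite /dev; case: (k) => [|k']; ring.
  rewrite big_ord_recr/= binn subnn sigma0//; congr (_ + _ + _).
  by rewrite exprS; ring.
have dn := damp_neq0 m0 b1.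
apply: (mulfI dn); rewrite /damp mulVKf//.
by rewrite mulrBl mul1r {1}E; ring.
Qed.

Lemma near_dev_rec k m : (0 < m)%N -> \forall b \near \oo,
  damp m b *
    (\sum_(i < m) 'C(m, i)%:R * (b%:R^-1 ^+ i * sigma (m - i) b * dev k i b)
     + b%:R^-1 ^+ m.+1 * \sum_(i < m.+1) 'C(m, i)%:R * d%:R ^+ (m - i) *
         (if k is k'.+1 then dev k' i b else - (b%:R / i.+1%:R))) = dev k m b.
Proof. by move=> m0; apply: filterS near_digit => b [b1 db]; rewrite -dev_rec. Qed.

Lemma near_dev0_rec m : (0 < m)%N -> \forall b \near \oo,
  damp m b *
    (\sum_(i < m) 'C(m, i)%:R * (b%:R^-1 ^+ i * sigma (m - i) b * dev 0 i b)
     - b%:R^-1 ^+ m * \sum_(i < m.+1) 'C(m, i)%:R * d%:R ^+ (m - i) / i.+1%:R)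
  = dev 0 m b.
Proof.
move=> m0; near=> b.
have <- : damp m b *
    (\sum_(i < m) 'C(m, i)%:R * (b%:R^-1 ^+ i * sigma (m - i) b * dev 0 i b)
     + b%:R^-1 ^+ m.+1 * \sum_(i < m.+1) 'C(m, i)%:R * d%:R ^+ (m - i) *
         - (b%:R / i.+1%:R)) = dev 0 m b.
  by near: b; exact: (near_dev_rec 0).
congr (_ * (_ + _)); rewrite -mulrN -sumrN exprSr -mulrA; congr (_ * _).
rewrite mulr_sumr; apply: eq_bigr => i _.
have bR : b%:R != 0 :> R by rewrite pnatr_eq0 -lt0n; near: b; exists 1%N.
by move: (i.+1%:R^-1) => v; field.
Unshelve. all: by end_near. Qed.

Lemma expandable_dev0 m : expandable (dev 0 m).
Proof.
elim/ltn_ind: m => -[|m] IHm.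
  apply: expandable_near (expandable_cst (0 : R)).
  by apply: filterS (dev_mass 0).
apply: expandable_near (near_dev0_rec (ltn0Sn m)) _.
apply: expandableM; first exact: expandable_damp.
apply: expandableB.
  apply: expandable_sum => i _; apply: expandableZ; apply: expandableM; last exact: IHm.
  apply: expandableM; last exact: expandable_sigma.
  by apply: expandableX; exact: expandable_inv.
apply: expandableM; last exact: expandable_cst.
by apply: expandableX; exact: expandable_inv.
Qed.

Lemma expandable_dev1 m : expandable (dev 1 m).
Proof.
elim/ltn_ind: m => -[|m] IHm.
  apply: expandable_near (expandable_cst (0 : R)).
  by apply: filterS (dev_mass 1).
apply: expandable_near (near_dev_rec 1 (ltn0Sn m)) _.
apply: expandableM; first exact: expandable_damp.
apply: expandableD.
  apply: expandable_sum => i _; apply: expandableZ; apply: expandableM; last exact: IHm.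
  apply: expandableM; last exact: expandable_sigma.
  by apply: expandableX; exact: expandable_inv.
apply: expandableM; first by apply: expandableX; exact: expandable_inv.
apply: expandable_sum => i _; apply: expandableM; first exact: expandable_cst.
exact: expandable_dev0.
Qed.

Lemma Oinv_sigma k : Oinv 0 (sigma k).
Proof. by apply: expandable_Oinv0; exact: expandable_sigma. Qed.

Lemma Oinv_dev_mass N k : Oinv N (dev k 0).
Proof. by apply: Oinv_near (Oinv0 R N); apply: filterS (dev_mass k). Qed.

(** The term i = 0 vanishes and every other one gains a factor 1/b. *)
Lemma Oinv_rec_terms k m N : (forall i, (i < m)%N -> Oinv N (dev k i)) ->
  Oinv N.+1 (fun b => \sum_(i < m)
    'C(m, i)%:R * (b%:R^-1 ^+ i * sigma (m - i) b * dev k i b)).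
Proof.
move=> IH; apply: Oinv_sum => i _; apply: OinvZ.
have sO j : Oinv j (fun b => b%:R^-1 ^+ j * sigma (m - i) b).
  by have := OinvM (Oinv_exp R j) (Oinv_sigma (m - i)); rewrite addn0.
case: (posnP i) => [i0|i0].
  rewrite i0; have := OinvM (sO 0%N) (Oinv_dev_mass N.+1 k); rewrite add0n i0.
  exact.
apply: Oinv_le (OinvM (sO i) (IH i (ltn_ord i))).
by rewrite -add1n leq_add2r.
Qed.

Lemma Oinv_dev0 m : Oinv 1 (dev 0 m).
Proof.
elim/ltn_ind: m => -[|m] IHm; first exact: Oinv_dev_mass.
apply: Oinv_near (near_dev0_rec (ltn0Sn m)) _.
apply: OinvMl; first exact: Oinv_damp.
apply: OinvB; first by apply: Oinv_le (Oinv_rec_terms IHm).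
have := OinvM (Oinv_exp R m.+1) (Oinv_cst
  (\sum_(i < m.+2) 'C(m.+1, i)%:R * d%:R ^+ (m.+1 - i) / i.+1%:R : R)).
by rewrite addn0; apply: Oinv_le.
Qed.

Lemma Oinv_dev0_high m : m != 1%N -> Oinv 2 (dev 0 m).
Proof.
case: m => [|[|m]]// _; first exact: Oinv_dev_mass.
apply: Oinv_near (near_dev0_rec (ltn0Sn m.+1)) _.
apply: OinvMl; first exact: Oinv_damp.
apply: OinvB; first by apply: Oinv_rec_terms => i _; exact: Oinv_dev0.
have := OinvM (Oinv_exp R m.+2) (Oinv_cst
  (\sum_(i < m.+3) 'C(m.+2, i)%:R * d%:R ^+ (m.+2 - i) / i.+1%:R : R)).
by rewrite addn0; apply: Oinv_le.
Qed.

Lemma Oinv_dev1_source m : Oinv m.+2 (fun b => b%:R^-1 ^+ m.+1 *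
  \sum_(i < m.+1) 'C(m, i)%:R * d%:R ^+ (m - i) * dev 0 i b).
Proof.
rewrite -addn1; apply: OinvM; first exact: Oinv_exp.
by apply: Oinv_sum => i _; apply: OinvZ; exact: Oinv_dev0.
Qed.

Lemma Oinv_dev1 m : Oinv 3 (dev 1 m).
Proof.
elim/ltn_ind: m => -[|m] IHm; first exact: Oinv_dev_mass.
apply: Oinv_near (near_dev_rec 1 (ltn0Sn m)) _.
apply: OinvMl; first exact: Oinv_damp.
apply: OinvD; first by apply: Oinv_le (Oinv_rec_terms IHm).
by apply: Oinv_le (Oinv_dev1_source m.+1).
Qed.

Lemma Oinv_dev1_high m : m != 1%N -> Oinv 4 (dev 1 m).
Proof.
case: m => [|[|m]]// _; first exact: Oinv_dev_mass.
apply: Oinv_near (near_dev_rec 1 (ltn0Sn m.+1)) _.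
apply: OinvMl; first exact: Oinv_damp.
apply: OinvD; first by apply: Oinv_rec_terms => i _; exact: Oinv_dev1.
by apply: Oinv_le (Oinv_dev1_source m.+2).
Qed.

End Moments.

(** * Sums over the two-digit numbers *)

Section DigitSums.
Variables (R : realType) (d : nat).
Hypothesis d_gt0 : (0 < d)%N.
Implicit Types (b j k N s : nat).

Lemma expandable_zeta_head s : (1 < s)%N ->
  expandable (fun b => \sum_(1 <= a < b) (a%:R ^+ s)^-1 : R).
Proof.
move=> s1; apply: (@expandable_ext _ (fun b => zeta R s - zeta_tail R s b)).
  by move=> b; rewrite /zeta_tail opprB addrC subrK.
by apply: expandableB; [exact: expandable_cst | exact: expandable_zeta_tail].
Qed.

(** An expansion of (1 + d/n)^-s, used at n = a b, is summed over a; the bound is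
    uniform in a since a b >= b. *)
Lemma unit_sum_approx s N k (r : nat -> R) : (1 < s)%N ->
  Oinv N (fun n => (1 + d%:R * n%:R^-1)^-1 ^+ s - \sum_(i < k) r i * n%:R^-1 ^+ i) ->
  Oinv (s + N) (fun b => unit_sum b d R s -
    \sum_(i < k) r i * (b%:R^-1 ^+ (s + i) *
       \sum_(1 <= a < b) (a%:R ^+ (s + i))^-1)).
Proof.
move=> s1 /Oinv_ge0[C C0 [B _ rC]]; exists (C * 2); near=> b.
have b0 : (0 < b)%N by near: b; exists 1%N.
have Bb : (B <= b)%N by near: b; exists B.
have -> : \sum_(i < k) r i * (b%:R^-1 ^+ (s + i) *
       \sum_(1 <= a < b) (a%:R ^+ (s + i))^-1) =
    \sum_(1 <= a < b) (a * b)%:R^-1 ^+ s * \sum_(i < k) r i * (a * b)%:R^-1 ^+ i.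
  under eq_bigr => i _ do rewrite 2!mulr_sumr.
  rewrite exchange_big/=; apply: eq_bigr => a _.
  rewrite mulr_sumr; apply: eq_bigr => i _.
  by rewrite natrM invfM !exprMn -exprVn !exprD; ring.
rewrite -sumrB (le_trans (ler_norm_sum _ _ _))//.
apply: (@le_trans _ _ (\sum_(1 <= a < b) C * b%:R^-1 ^+ (s + N) * (a%:R ^+ s)^-1)); last first.
  rewrite -mulr_sumr mulrAC ler_wpM2r ?exprn_ge0 ?invr_ge0//.
  by rewrite ler_wpM2l// zeta_sum_le.
rewrite big_nat [leRHS]big_nat; apply: ler_sum => a /andP[a0 _].
have ab0 : (0 < a * b)%N by rewrite muln_gt0 a0.
have abR : (a * b)%:R != 0 :> R by rewrite pnatr_eq0 -lt0n.
have dR : (a * b)%:R + d%:R != 0 :> R by rewrite -natrD pnatr_eq0 addn_eq0 (gtn_eqF ab0).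
have -> : ((a * b + d)%:R ^+ s)^-1 =
   (a * b)%:R^-1 ^+ s * (1 + d%:R * (a * b)%:R^-1)^-1 ^+ s :> R.
  rewrite -exprMn -invfM -exprVn natrD; congr (_^-1 ^+ _).
  by rewrite mulrDr mulr1 mulrCA mulfV// mulr1.
rewrite -mulrBr normrM ger0_norm; last by rewrite exprn_ge0// invr_ge0.
have abB : (B <= a * b)%N by rewrite (leq_trans Bb)// leq_pmull.
apply: le_trans (ler_wpM2l _ (rC _ abB)) _; first by rewrite exprn_ge0// invr_ge0.
rewrite natrM invfM !exprMn exprD.
have aN : a%:R^-1 ^+ N <= 1 :> R.
  by rewrite exprn_ile1 ?invr_ge0// invn_le1.
have as0 : 0 <= (a%:R ^+ s)^-1 :> R by rewrite invr_ge0 exprn_ge0.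
have bs0 : 0 <= b%:R^-1 ^+ s :> R by rewrite exprn_ge0 ?invr_ge0.
have bN0 : 0 <= b%:R^-1 ^+ N :> R by rewrite exprn_ge0 ?invr_ge0.
rewrite [leLHS](_ : _ = C * (b%:R^-1 ^+ s * b%:R^-1 ^+ N) * (a%:R ^+ s)^-1
  * a%:R^-1 ^+ N); last by rewrite -exprVn; ring.
by rewrite ler_piMr// !mulr_ge0.
Unshelve. all: by end_near. Qed.

Lemma Oinv_unit_sum s : (1 < s)%N -> Oinv s (fun b => unit_sum b d R s).
Proof.
move=> s1; have := @unit_sum_approx s 0 0 (fun=> 0) s1; rewrite addn0 => H.
apply: Oinv_ext (H _); first by move=> b; rewrite big_ord0 subr0.
apply: (@Oinv_ext _ _ (fun n => (1 + d%:R * n%:R^-1)^-1 ^+ s)).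
  by move=> n; rewrite big_ord0 subr0.
by rewrite -(muln0 s); apply: OinvX; exact: Oinv_1Dinv.
Qed.

Lemma expandable_unit_sum s : (1 < s)%N -> expandable (fun b => unit_sum b d R s).
Proof.
move=> s1; apply: expandable_approx => N.
have [r rN] := expandableX s (@expandable_1Dinv R d%:R) N.
exists (fun b => \sum_(i < size r) r`_i * (b%:R^-1 ^+ (s + i) *
       \sum_(1 <= a < b) (a%:R ^+ (s + i))^-1)); last first.
  apply: Oinv_le (unit_sum_approx s1 (Oinv_ext _ rN)); first exact: leq_addl.
  by move=> n; rewrite horner_coef.
apply: expandable_sum => i _; apply: expandableZ; apply: expandableM.
  by apply: expandableX; exact: expandable_inv.
by apply: expandable_zeta_head; rewrite (leq_trans s1)// leq_addr.
Qed.

Lemma expandable_inv_mul (c : nat) : expandable (fun b => (c * b)%:R^-1 : R).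
Proof.
apply: (@expandable_ext _ (fun b => c%:R^-1 * b%:R^-1)).
  by move=> b; rewrite natrM invfM.
by apply: expandableZ; exact: expandable_inv.
Qed.

Lemma near_le_mul (c : nat) : (0 < c)%N -> \forall b \near \oo, (b <= c * b)%N.
Proof. by move=> c0; exists 0%N => // b _; rewrite leq_pmull. Qed.

Lemma near_le_sqr : \forall b \near \oo, (b <= b ^ 2)%N.
Proof. by exists 1%N => // b /= b0; rewrite -mulnn leq_pmull. Qed.

Lemma lead_sumE s b : (0 < b)%N ->
  lead_sum b d R s = zeta_tail R s (d * b) - zeta_tail R s (d.+1 * b).
Proof.
move=> b0; rewrite zeta_tailB ?muln_gt0 ?d_gt0// ?leq_mul//.
rewrite -{1}[(d * b)%N]add0n big_addn mulSn addnK.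
by apply: eq_bigr => c _; rewrite addnC.
Qed.

Lemma near_lead_sum s : \forall b \near \oo,
  zeta_tail R s (d * b) - zeta_tail R s (d.+1 * b) = lead_sum b d R s.
Proof. by exists 1%N => // b b0; rewrite lead_sumE. Qed.

Lemma expandable_lead_sum s : (1 < s)%N -> expandable (fun b => lead_sum b d R s).
Proof.
move=> s1; apply: expandable_near (near_lead_sum s) _.
by apply: expandableB; apply: expandable_comp;
  [exact: near_le_mul|exact: expandable_inv_mul|exact: expandable_zeta_tail|
   exact: near_le_mul|exact: expandable_inv_mul|exact: expandable_zeta_tail].
Qed.

Lemma Oinv_lead_sum s : (1 < s)%N -> Oinv s.-1 (fun b => lead_sum b d R s).
Proof.
move=> s1; apply: Oinv_near (near_lead_sum s) _.
by apply: OinvB; apply: Oinv_comp;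
  [exact: near_le_mul|exact: Oinv_zeta_tail|
   exact: near_le_mul|exact: Oinv_zeta_tail].
Qed.

(** The sum of A^-s over all two-digit A. *)
Definition two_digit_sum s b : R := \sum_(b <= A < (b ^ 2)%N) (A%:R ^+ s)^-1.

Lemma near_two_digit_sum s : \forall b \near \oo,
  zeta_tail R s b - zeta_tail R s (b ^ 2)%N = two_digit_sum s b.
Proof.
exists 1%N => // b b0; rewrite zeta_tailB// -mulnn leq_pmull//.
Qed.

Lemma expandable_two_digit_sum s : (1 < s)%N -> expandable (two_digit_sum s).
Proof.
move=> s1; apply: expandable_near (near_two_digit_sum s) _.
apply: expandableB; first exact: expandable_zeta_tail.
apply: expandable_comp; [exact: near_le_sqr| |exact: expandable_zeta_tail].
apply: (@expandable_ext _ (fun b => b%:R^-1 ^+ 2)).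
  by move=> b; rewrite natrX exprVn.
by apply: expandableX; exact: expandable_inv.
Qed.

Lemma Oinv_two_digit_sum s : (1 < s)%N -> Oinv s.-1 (two_digit_sum s).
Proof.
move=> s1; apply: Oinv_near (near_two_digit_sum s) _.
apply: OinvB; first exact: Oinv_zeta_tail.
by apply: Oinv_comp; [exact: near_le_sqr|exact: Oinv_zeta_tail].
Qed.

(** b/(b + 1), as a function of 1/b; the inverse of the number dd is this ratio
    divided by d b. *)
Definition ratio b : R := (1 + 1 * b%:R^-1)^-1.

Lemma double_digit_inv b : (0 < b)%N ->
  (d * b + d)%:R^-1 = d%:R^-1 * (b%:R^-1 * ratio b) :> R.
Proof.
move=> b0; have bR : 0 < b%:R :> R by rewrite ltr0n.
have dR : 0 < d%:R :> R by rewrite ltr0n.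
rewrite /ratio natrD natrM; field.
by rewrite !gt_eqF ?addr_gt0 ?mulr_gt0// mulrC addrC.
Qed.

Lemma expandable_ratio : expandable ratio.
Proof. exact: expandable_1Dinv. Qed.

Lemma Oinv_ratio : Oinv 0 ratio.
Proof. exact: Oinv_1Dinv. Qed.

Lemma near_double_digit_pow s : \forall b \near \oo,
  d%:R^-1 ^+ s * (b%:R^-1 ^+ s * ratio b ^+ s) = ((d * b + d)%:R ^+ s)^-1 :> R.
Proof.
by exists 1%N => // b b0; rewrite -exprVn double_digit_inv// !exprMn.
Qed.

Lemma expandable_double_digit_pow s :
  expandable (fun b => ((d * b + d)%:R ^+ s)^-1 : R).
Proof.
apply: expandable_near (near_double_digit_pow s) _.
apply: expandableZ; apply: expandableM; apply: expandableX;
  [exact: expandable_inv | exact: expandable_ratio].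
Qed.

Lemma Oinv_double_digit_pow s : Oinv s (fun b => ((d * b + d)%:R ^+ s)^-1 : R).
Proof.
apply: Oinv_near (near_double_digit_pow s) _.
apply: OinvZ; rewrite -[s in Oinv s]addn0; apply: OinvM; first exact: Oinv_exp.
by rewrite -(muln0 s); apply: OinvX; exact: Oinv_ratio.
Qed.

Lemma near_prefix_sum1 s : \forall b \near \oo,
  lead_sum b d R s + unit_sum b d R s - 2 * ((d * b + d)%:R ^+ s)^-1
  = prefix_sum b d R 1 s.
Proof.
by apply: filterS (near_digit d_gt0) => b [b1 db]; rewrite prefix_sum1.
Qed.

Lemma near_prefix_sum0 s : \forall b \near \oo,
  two_digit_sum s b - lead_sum b d R s - unit_sum b d R s
    + ((d * b + d)%:R ^+ s)^-1 = prefix_sum b d R 0 s.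
Proof.
by apply: filterS (near_digit d_gt0) => b [b1 db]; rewrite prefix_sum0.
Qed.

Lemma expandable_prefix_sum1 s : (1 < s)%N -> expandable (fun b => prefix_sum b d R 1 s).
Proof.
move=> s1; apply: expandable_near (near_prefix_sum1 s) _.
apply: expandableB; last by apply: expandableZ; exact: expandable_double_digit_pow.
by apply: expandableD; [exact: expandable_lead_sum | exact: expandable_unit_sum].
Qed.

Lemma Oinv_prefix_sum1 s : (1 < s)%N -> Oinv s.-1 (fun b => prefix_sum b d R 1 s).
Proof.
move=> s1; apply: Oinv_near (near_prefix_sum1 s) _.
apply: OinvB; last by apply: OinvZ; apply: Oinv_le (Oinv_double_digit_pow s); exact: leq_pred.
apply: OinvD; first exact: Oinv_lead_sum.
by apply: Oinv_le (Oinv_unit_sum s1); exact: leq_pred.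
Qed.

Lemma expandable_prefix_sum0 s : (1 < s)%N -> expandable (fun b => prefix_sum b d R 0 s).
Proof.
move=> s1; apply: expandable_near (near_prefix_sum0 s) _.
apply: expandableD; last exact: expandable_double_digit_pow.
apply: expandableB; last exact: expandable_unit_sum.
by apply: expandableB; [exact: expandable_two_digit_sum | exact: expandable_lead_sum].
Qed.

Lemma Oinv_prefix_sum0 s : (1 < s)%N -> Oinv s.-1 (fun b => prefix_sum b d R 0 s).
Proof.
move=> s1; apply: Oinv_near (near_prefix_sum0 s) _.
apply: OinvD; last by apply: Oinv_le (Oinv_double_digit_pow s); exact: leq_pred.
apply: OinvB; last by apply: Oinv_le (Oinv_unit_sum s1); exact: leq_pred.
by apply: OinvB; [exact: Oinv_two_digit_sum | exact: Oinv_lead_sum].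
Qed.

End DigitSums.

(** * The logarithm *)

Section Logarithm.
Variable R : realType.

Lemma is_derive_ln1D_poly J (x : R) :
  is_derive x 1 (fun x : R => \sum_(j < J) (-1) ^+ j / j.+1%:R * x ^+ j.+1)
    (\sum_(j < J) (- x) ^+ j).
Proof.
elim: J => [|J IHJ].
  rewrite big_ord0 (_ : (fun _ => _) = cst 0); first exact: is_derive_cst.
  by apply/funext => y; rewrite big_ord0.
rewrite big_ord_recr/= (_ : (fun _ => _) =
    (fun x : R => \sum_(j < J) (-1) ^+ j / j.+1%:R * x ^+ j.+1) +
    ((-1) ^+ J / J.+1%:R) \*: ((fun x : R => x) ^+ J.+1)); last first.
  by apply/funext => y; rewrite exprfctE; exact: big_ord_recr.
apply: is_deriveD.
have J0 : J.+1%:R != 0 :> R by rewrite pnatr_eq0.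
have dX := is_deriveX J.+1 (is_derive_id x (1 : R)).
have dZ := is_deriveZ ((-1) ^+ J / J.+1%:R) dX.
apply: (is_derive_eq dZ).
rewrite /GRing.scale/= mulr1 [(- x) ^+ J]exprNn.
by move: J0; move: (J.+1%:R : R) => v v0; field.
Qed.

Lemma ln1D_approx (t : R) J : 0 <= t ->
  `|ln (1 + t) - \sum_(j < J) (-1) ^+ j / j.+1%:R * t ^+ j.+1| <= t ^+ J.+1.
Proof.
rewrite le_eqVlt => /predU1P[<-|t0].
  rewrite addr0 ln1 big1 ?subrr ?normr0 ?exprn_ge0// => j _.
  by rewrite exprS mul0r mulr0.
pose p (x : R) := \sum_(j < J) (-1) ^+ j / j.+1%:R * x ^+ j.+1.
pose f (x : R) := ln (1 + x) - p x.
pose f' (x : R) := (1 + x)^-1 - \sum_(j < J) (- x) ^+ j.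
have fd (x : R) : 0 <= x -> is_derive x 1 f (f' x).
  move=> x0; have x1 : 0 < 1 + x by lra.
  have d1 : is_derive x 1 (fun x : R => 1 + x) (1 : R).
    by have := is_deriveD (is_derive_cst (1 : R) x (1 : R)) (is_derive_id x (1 : R)); rewrite add0r.
  have dl := @is_derive1_comp R (@ln R) (fun x => 1 + x) x _ _ (is_derive1_ln x1) d1.
  have := is_deriveB dl (is_derive_ln1D_poly J x).
  by rewrite mulr1.
have [c||c /andP[c0 ct]] := @MVT R f f' 0 t t0.
- by rewrite in_itv/= => /andP[c0 _]; apply: fd; exact: ltW.
- apply: continuous_in_subspaceT => x; rewrite inE/= in_itv/= => /andP[x0 _].
  apply: differentiable_continuous; apply/derivable1_diffP.
  by have := fd x x0 => -[].
rewrite /f addr0 ln1 /p [X in _ - (0 - X)]big1 ?subr0; last first.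
  by move=> j _; rewrite exprS mul0r mulr0.
move=> ->; rewrite !bnd_simp in c0 ct.
rewrite normrM (gtr0_norm t0) exprSr ler_wpM2r ?(ltW t0)//.
apply: le_trans (geom_alternating_le J (ltW c0)) _.
by rewrite lerXn2r ?nnegrE ?(ltW c0) ?(ltW t0) ?(ltW ct).
Qed.

(** log b is the telescoping sum of log(1 + 1/A) over the two-digit A. *)
Lemma ln_two_digit_approx b J : (1 < b)%N ->
  `|b%:R * ln b%:R - \sum_(j < J) (-1) ^+ j * (b%:R / j.+1%:R) * two_digit_sum R j.+1 b|
  <= b%:R ^+ 3 * b%:R^-1 ^+ J.+1.
Proof.
move=> b1; have b0 : (0 < b)%N by exact: ltnW.
have bR : 0 < b%:R :> R by rewrite ltr0n.
have bb : (b <= b ^ 2)%N by rewrite -mulnn leq_pmull.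
have lnA A : (0 < A)%N -> ln A.+1%:R - ln A%:R = ln (1 + A%:R^-1) :> R.
  move=> A0; have AR : 0 < A%:R :> R by rewrite ltr0n.
  rewrite -ln_div ?posrE ?ltr0n//; congr ln.
  by rewrite -natr1; field; rewrite gt_eqF.
have -> : ln b%:R = \sum_(b <= A < (b ^ 2)%N) ln (1 + A%:R^-1) :> R.
  rewrite (eq_big_nat _ _ (F2 := fun A => ln A.+1%:R - ln A%:R)); last first.
    by move=> A /andP[bA _]; rewrite lnA// (leq_trans b0).
  rewrite telescope_sumr// natrX lnXn// mulr2n; lra.
have -> : \sum_(j < J) (-1) ^+ j * (b%:R / j.+1%:R) * two_digit_sum R j.+1 b =
    b%:R * \sum_(b <= A < (b ^ 2)%N) \sum_(j < J) (-1) ^+ j / j.+1%:R * A%:R^-1 ^+ j.+1.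
  rewrite exchange_big/= mulr_sumr; apply: eq_bigr => j _.
  rewrite /two_digit_sum -mulr_sumr [RHS]mulrA; congr (_ * _); first by ring.
  by apply: eq_bigr => A _; rewrite exprVn.
rewrite -mulrBr -sumrB normrM (gtr0_norm bR).
have -> : b%:R ^+ 3 * b%:R^-1 ^+ J.+1 = b%:R * (b%:R ^+ 2 * b%:R^-1 ^+ J.+1) :> R.
  by rewrite mulrA -exprS.
rewrite ler_wpM2l ?(ltW bR)// (le_trans (ler_norm_sum _ _ _))//.
have y0 : 0 <= b%:R^-1 ^+ J.+1 :> R by rewrite exprn_ge0 ?invr_ge0.
apply: (@le_trans _ _ (\sum_(b <= A < (b ^ 2)%N) b%:R^-1 ^+ J.+1)).
  rewrite big_nat [leRHS]big_nat; apply: ler_sum => A /andP[bA _].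
  have A0 : (0 < A)%N by rewrite (leq_trans b0).
  apply: le_trans (ln1D_approx J _) _; first by rewrite invr_ge0.
  rewrite lerXn2r ?nnegrE ?invr_ge0//.
  by rewrite lef_pV2 ?posrE ?ltr0n// ler_nat.
rewrite big_const_nat iter_addr_0 -[leLHS]mulr_natl ler_wpM2r//.
by rewrite -natrX ler_nat leq_subr.
Qed.

End Logarithm.

(** * Existence of the expansion *)

Section Assembly.
Variables (R : realType) (d : nat).
Hypothesis d_gt0 : (0 < d)%N.
Implicit Types (b j k N s : nat).

(** What b times Lebesgue measure leaves once b log b is subtracted: the one-digit
    number d and the missing prefix dd. *)
Definition log_part J b : R := d%:R^-1 -
  \sum_(j < J) (-1) ^+ j * (b%:R / j.+1%:R) * ((d * b + d)%:R ^+ j.+1)^-1.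

(** The contribution of the deviations from b times Lebesgue measure. *)
Definition dev_part J b : R :=
  \sum_(j < J) (-1) ^+ j * (dev R d 1 j b * prefix_sum b d R 0 j.+1 +
                            dev R d 0 j b * prefix_sum b d R 1 j.+1).

Lemma irwin_decomposition N : Oinv N (fun b =>
  irwin R b d 1 - b%:R * ln b%:R - (log_part N.+2 b + dev_part N.+2 b)).
Proof.
exists 2; near=> b.
have [b1 db] : (1 < b)%N /\ (d < b)%N by near: b; exact: near_digit.
have bR : b%:R != 0 :> R by rewrite pnatr_eq0 -lt0n ltnW.
have E : b%:R ^+ 3 * b%:R^-1 ^+ N.+3 = b%:R^-1 ^+ N :> R.
  by rewrite -[N.+3]/(3 + N)%N exprD mulrA -exprMn mulfV// expr1n mul1r.
have := irwin_approx b1 d_gt0 db R N.+2; rewrite E.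
have := ln_two_digit_approx R N.+2 b1; rewrite E.
set X := (\sum_(j < N.+2) _) => lnX; set Y := (d%:R^-1 + _) => irwinY.
have -> : log_part N.+2 b + dev_part N.+2 b = Y - X.
  rewrite /log_part /dev_part /Y /X -!addrA; congr (_ + _).
  rewrite -sumrN -!sumrN -!big_split/=; apply: eq_bigr => j _.
  rewrite prefix_sum0// prefix_sum1// -/(two_digit_sum R j.+1 b) /dev.
  by ring.
rewrite (_ : _ - _ = (irwin R b d 1 - Y) - (b%:R * ln b%:R - X)); last by ring.
rewrite (le_trans (ler_normB _ _))//; lra.
Unshelve. all: by end_near. Qed.

Lemma near_log_part J : \forall b \near \oo,
  d%:R^-1 - \sum_(j < J) (-1) ^+ j / j.+1%:R * d%:R^-1 ^+ j.+1 *
    (b%:R^-1 ^+ j * ratio R b ^+ j.+1) = log_part J b.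
Proof.
exists 1%N => // b /= b0; congr (_ - _); apply: eq_bigr => j _.
have bR : b%:R != 0 :> R by rewrite pnatr_eq0 -lt0n.
rewrite -exprVn double_digit_inv// !exprMn.
have -> : b%:R^-1 ^+ j = b%:R * b%:R^-1 ^+ j.+1 :> R.
  by rewrite exprS mulVKf.
by ring.
Qed.

Lemma expandable_log_part J : expandable (log_part J).
Proof.
apply: expandable_near (near_log_part J) _.
apply: expandableB; first exact: expandable_cst.
apply: expandable_sum => j _; apply: expandableZ; apply: expandableM;
  apply: expandableX; [exact: expandable_inv | exact: expandable_ratio].
Qed.

Lemma expandable_dev_part J : expandable (dev_part J).
Proof.
apply: expandable_sum => -[[|j] jJ] _ /=; apply: expandableZ.
  apply: expandable_near (expandable_cst (0 : R)).
  apply: filterS2 (dev_mass R d_gt0 0) (dev_mass R d_gt0 1) => b -> ->.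
  by rewrite !mul0r addr0.
apply: expandableD; apply: expandableM.
- exact: expandable_dev1.
- exact: expandable_prefix_sum0.
- exact: expandable_dev0.
- exact: expandable_prefix_sum1.
Qed.

Lemma expandable_irwin : expandable (fun b => irwin R b d 1 - b%:R * ln b%:R).
Proof.
apply: expandable_approx => N; exists (fun b => log_part N.+2 b + dev_part N.+2 b).
  by apply: expandableD; [exact: expandable_log_part | exact: expandable_dev_part].
exact: irwin_decomposition.
Qed.

End Assembly.

(** * The first five coefficients *)

Section Coefficients.
Variables (R : realType) (d : nat).
Hypothesis d_gt0 : (0 < d)%N.
Implicit Types (b j k N s : nat).
Let x : R := d%:R.
Let e : R := x^-1.
Let f : R := (x + 1)^-1.
Let h : R := x + 1 / 2.

Lemma OinvM_le M N K (F G : nat -> R) : (K <= M + N)%N ->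
  Oinv M F -> Oinv N G -> Oinv K (fun b => F b * G b).
Proof. by move=> KMN FM GN; apply: Oinv_le KMN (OinvM FM GN). Qed.

Lemma Oinv_monom N k (c : R) : (N <= k)%N -> Oinv N (fun b => c * b%:R^-1 ^+ k).
Proof. by move=> Nk; apply: OinvZ; exact: Oinv_le Nk (Oinv_exp R k). Qed.

(** The truncation p of the expansion of (1 + y)^-k is certified by the
    cofactor c of y^N in 1 - p (1 + y)^k. *)
Lemma ratio_pow_approx k N (p : R -> R) (c : {poly R}) :
  (forall y, 1 - p y * (1 + y) ^+ k = y ^+ N * c.[y]) ->
  Oinv N (fun b => ratio R b ^+ k - p b%:R^-1).
Proof.
move=> pc; apply: (@Oinv_succ_rational _ _ (fun b => c.[b%:R^-1]) k).
  exact: Oinv_horner.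
move=> b b0; have y0 : 0 <= b%:R^-1 :> R by rewrite invr_ge0.
rewrite mulrA -pc /ratio mul1r mulrBl mul1r -mulrA -exprMn mulfV ?expr1n ?mulr1//.
Qed.

Lemma zeta_tail2_mul (c : nat) : (0 < c)%N -> Oinv 5 (fun b => zeta_tail R 2 (c * b) -
  (c%:R^-1 * b%:R^-1 + c%:R^-1 ^+ 2 / 2 * b%:R^-1 ^+ 2 + c%:R^-1 ^+ 3 / 6 * b%:R^-1 ^+ 3)).
Proof.
move=> c0; apply: Oinv_ext (Oinv_comp (near_le_mul c0) (zeta_tail2 R)) => b.
by rewrite natrM invfM; ring.
Qed.

Lemma zeta_tail3_mul (c : nat) : (0 < c)%N -> Oinv 4 (fun b => zeta_tail R 3 (c * b) -
  (c%:R^-1 ^+ 2 / 2 * b%:R^-1 ^+ 2 + c%:R^-1 ^+ 3 / 2 * b%:R^-1 ^+ 3)).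
Proof.
move=> c0; apply: Oinv_ext (Oinv_comp (near_le_mul c0) (zeta_tail3 R)) => b.
by rewrite natrM invfM; ring.
Qed.

Lemma zeta_tail4_mul (c : nat) : (0 < c)%N -> Oinv 4 (fun b => zeta_tail R 4 (c * b) -
  c%:R^-1 ^+ 3 / 3 * b%:R^-1 ^+ 3).
Proof.
move=> c0; apply: Oinv_ext (Oinv_comp (near_le_mul c0) (zeta_tail4 R)) => b.
by rewrite natrM invfM; ring.
Qed.

Let fE : d.+1%:R^-1 = f. Proof. by rewrite -natr1. Qed.

Lemma lead_sum2_approx : Oinv 5 (fun b => lead_sum b d R 2 -
  ((e - f) * b%:R^-1 + (e ^+ 2 - f ^+ 2) / 2 * b%:R^-1 ^+ 2
   + (e ^+ 3 - f ^+ 3) / 6 * b%:R^-1 ^+ 3)).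
Proof.
have H := OinvB (zeta_tail2_mul d_gt0) (zeta_tail2_mul (ltn0Sn d)).
apply: Oinv_near H; apply: filterS (near_lead_sum R d_gt0 2) => b <-.
by rewrite fE -/x -/e; ring.
Qed.

Lemma lead_sum3_approx : Oinv 4 (fun b => lead_sum b d R 3 -
  ((e ^+ 2 - f ^+ 2) / 2 * b%:R^-1 ^+ 2 + (e ^+ 3 - f ^+ 3) / 2 * b%:R^-1 ^+ 3)).
Proof.
have H := OinvB (zeta_tail3_mul d_gt0) (zeta_tail3_mul (ltn0Sn d)).
apply: Oinv_near H; apply: filterS (near_lead_sum R d_gt0 3) => b <-.
by rewrite fE -/x -/e; ring.
Qed.

Lemma lead_sum4_approx : Oinv 4 (fun b => lead_sum b d R 4 -
  (e ^+ 3 - f ^+ 3) / 3 * b%:R^-1 ^+ 3).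
Proof.
have H := OinvB (zeta_tail4_mul d_gt0) (zeta_tail4_mul (ltn0Sn d)).
apply: Oinv_near H; apply: filterS (near_lead_sum R d_gt0 4) => b <-.
by rewrite fE -/x -/e; ring.
Qed.

Lemma head_sumE s b :
  \sum_(1 <= a < b) (a%:R ^+ s)^-1 = zeta R s - zeta_tail R s b :> R.
Proof. by rewrite /zeta_tail opprB addrC subrK. Qed.

Lemma unit_sum2_approx : Oinv 5 (fun b => unit_sum b d R 2 -
  (zeta R 2 * b%:R^-1 ^+ 2 + (- 1 - 2 * x * zeta R 3) * b%:R^-1 ^+ 3
   + (- (1 / 2) + 3 * x ^+ 2 * zeta R 4) * b%:R^-1 ^+ 4)).
Proof.
pose r := nth 0 [:: 1; - (2 * x); 3 * x ^+ 2].
have H := @unit_sum_approx R d 2 3 3 r isT.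
have {}H := H _.
have U : Oinv 3 (fun n => (1 + d%:R * n%:R^-1)^-1 ^+ 2 - \sum_(i < 3) r i * n%:R^-1 ^+ i).
  apply: (@Oinv_ext _ _ (fun n => n%:R^-1 ^+ 3 * ((- 4 * x ^+ 3 - 3 * x ^+ 4 * n%:R^-1)
      * (1 + d%:R * n%:R^-1)^-1 ^+ 2))).
    move=> n; rewrite !big_ord_recl big_ord0 /r /= /bump /= -/x.
    have y0 : 0 <= n%:R^-1 :> R by rewrite invr_ge0.
    have x0 : 0 <= x by rewrite ler0n.
    move: (n%:R^-1) y0 => y y0.
    have xy := mulr_ge0 x0 y0.
    by field; rewrite gt_eqF//; lra.
  rewrite -[3%N]addn0; apply: OinvM; first exact: Oinv_exp.
  apply: OinvMl.
    apply: OinvB; first exact: Oinv_cst.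
    by apply: OinvZ; apply: Oinv_le (Oinv_inv R).
  by apply: (OinvX 2 (Oinv_1Dinv d%:R)).
have T2 : Oinv 3 (fun b => zeta_tail R 2 b - (b%:R^-1 + b%:R^-1 ^+ 2 / 2)).
  have T := OinvD (Oinv_le (isT : (3 <= 5)%N) (zeta_tail2 R))
     (Oinv_monom (6^-1) (leqnn 3)).
  by apply: Oinv_ext T => b; ring.
have T3 := @Oinv_zeta_tail R 3 isT.
have T4 := @Oinv_zeta_tail R 4 isT.
apply: (OinvB_trans (H U)).
have E : Oinv 5 (fun b => - (b%:R^-1 ^+ 2 * (zeta_tail R 2 b - (b%:R^-1 + b%:R^-1 ^+ 2 / 2)))
   + 2 * x * (b%:R^-1 ^+ 3 * zeta_tail R 3 b)
   - 3 * x ^+ 2 * (b%:R^-1 ^+ 4 * zeta_tail R 4 b)).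
  apply: OinvB; last first.
    by apply: OinvZ; apply: OinvM_le (Oinv_exp R 4) T4.
  apply: OinvD; first by apply: OinvN; exact: OinvM (Oinv_exp R 2) T2.
  by apply: OinvZ; exact: OinvM (Oinv_exp R 3) T3.
apply: Oinv_ext E => b; rewrite !big_ord_recl big_ord0 /r /= /bump /= !head_sumE.
by ring.
Qed.

Lemma unit_sum3_approx : Oinv 4 (fun b => unit_sum b d R 3 - zeta R 3 * b%:R^-1 ^+ 3).
Proof.
have H := @unit_sum_approx R d 3 1 1 (fun=> 1) isT.
have {}H := H _.
have U : Oinv 1 (fun n => (1 + d%:R * n%:R^-1)^-1 ^+ 3 - \sum_(i < 1) 1 * n%:R^-1 ^+ i : R).
  apply: (@Oinv_ext _ _ (fun n => n%:R^-1 * ((- 3 * x - 3 * x ^+ 2 * n%:R^-1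
      - x ^+ 3 * (n%:R^-1 * n%:R^-1)) * (1 + d%:R * n%:R^-1)^-1 ^+ 3))).
    move=> n; rewrite big_ord1 -/x.
    have y0 : 0 <= n%:R^-1 :> R by rewrite invr_ge0.
    have x0 : 0 <= x by rewrite ler0n.
    move: (n%:R^-1) y0 => y y0.
    have xy := mulr_ge0 x0 y0.
    by field; rewrite gt_eqF//; lra.
  have yO := Oinv_le (isT : (0 <= 1)%N) (Oinv_inv R).
  rewrite -[X in Oinv X]addn0; apply: OinvM; first exact: Oinv_inv.
  apply: OinvMl; last by apply: (OinvX 3 (Oinv_1Dinv d%:R)).
  apply: OinvB; last by apply: OinvZ; exact: (OinvM yO yO).
  by apply: OinvB; [exact: Oinv_cst | exact: OinvZ].
have T3 := @Oinv_zeta_tail R 3 isT.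
apply: (OinvB_trans (H U)).
have E : Oinv 4 (fun b => - (b%:R^-1 ^+ 3 * zeta_tail R 3 b)).
  by apply: OinvN; apply: OinvM_le (Oinv_exp R 3) T3.
by apply: Oinv_ext E => b; rewrite big_ord1 head_sumE; ring.
Qed.

(* The coefficients of the leading terms of N1_2 (n1 to n4), N0_2 (p1, p2),
   N1_3 (m2, m3) and N1_4 (r3). *)
Let n1 : R := e - f.
Let n2 : R := (e ^+ 2 - f ^+ 2) / 2 + zeta R 2 - 2 * e ^+ 2.
Let n3 : R := (e ^+ 3 - f ^+ 3) / 6 - 1 - 2 * x * zeta R 3 + 4 * e ^+ 2.
Let n4 : R := - (1 / 2) + 3 * x ^+ 2 * zeta R 4 - 6 * e ^+ 2.
Let p1 : R := 1 - (e - f).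
Let p2 : R := - (1 / 2) - (e ^+ 2 - f ^+ 2) / 2 - zeta R 2 + e ^+ 2.
Let m2 : R := (e ^+ 2 - f ^+ 2) / 2.
Let m3 : R := (e ^+ 3 - f ^+ 3) / 2 + zeta R 3 - 2 * e ^+ 3.
Let r3 : R := (e ^+ 3 - f ^+ 3) / 3.

Lemma ratio_sqr : Oinv 3 (fun b => ratio R b ^+ 2 -
  (1 - 2 * b%:R^-1 + 3 * b%:R^-1 ^+ 2)).
Proof.
apply: (@ratio_pow_approx 2 3 (fun y => 1 - 2 * y + 3 * y ^+ 2) (Poly [:: -4; -3])) => y.
by rewrite horner_Poly/=; ring.
Qed.

Lemma double_digit2 : Oinv 5 (fun b => ((d * b + d)%:R ^+ 2)^-1 -
  e ^+ 2 * (b%:R^-1 ^+ 2 - 2 * b%:R^-1 ^+ 3 + 3 * b%:R^-1 ^+ 4)).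
Proof.
have H := OinvZ (e ^+ 2) (OinvM (Oinv_exp R 2) ratio_sqr).
apply: Oinv_near H; apply: filterS (near_double_digit_pow R d_gt0 2) => b <-.
by rewrite -/x -/e; ring.
Qed.

Lemma prefix_sum1_2 : Oinv 5 (fun b => prefix_sum b d R 1 2 -
  (n1 * b%:R^-1 + n2 * b%:R^-1 ^+ 2 + n3 * b%:R^-1 ^+ 3 + n4 * b%:R^-1 ^+ 4)).
Proof.
have H := OinvB (OinvD lead_sum2_approx unit_sum2_approx) (OinvZ 2 double_digit2).
apply: Oinv_near H; apply: filterS (near_prefix_sum1 R d_gt0 2) => b <-.
by rewrite /n1 /n2 /n3 /n4; ring.
Qed.

Lemma two_digit_sum2 : Oinv 3 (fun b => two_digit_sum R 2 b - (b%:R^-1 - b%:R^-1 ^+ 2 / 2)).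
Proof.
have T := Oinv_le (isT : (3 <= 5)%N) (zeta_tail2 R).
have T' := Oinv_comp near_le_sqr T.
have M := OinvB (Oinv_monom (6^-1) (leqnn 3)) (OinvD
  (Oinv_monom (2^-1) (isT : (3 <= 4)%N)) (Oinv_monom (6^-1) (isT : (3 <= 6)%N))).
have H := OinvD (OinvB T T') M.
apply: Oinv_near H; apply: filterS (near_two_digit_sum R 2) => b <-.
rewrite natrX -exprVn.
by move: (b%:R^-1) => y; field.
Qed.

Lemma prefix_sum0_2 : Oinv 3 (fun b => prefix_sum b d R 0 2 -
  (p1 * b%:R^-1 + p2 * b%:R^-1 ^+ 2)).
Proof.
have L := Oinv_le (isT : (3 <= 5)%N) lead_sum2_approx.
have U := Oinv_le (isT : (3 <= 5)%N) unit_sum2_approx.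
have D := Oinv_le (isT : (3 <= 5)%N) double_digit2.
have M := OinvD (Oinv_monom (- ((e ^+ 3 - f ^+ 3) / 6) - (- 1 - 2 * x * zeta R 3)
     - 2 * e ^+ 2) (leqnn 3))
  (Oinv_monom (- (- (1 / 2) + 3 * x ^+ 2 * zeta R 4) + 3 * e ^+ 2) (isT : (3 <= 4)%N)).
have H := OinvD (OinvD (OinvB (OinvB two_digit_sum2 L) U) D) M.
apply: Oinv_near H; apply: filterS (near_prefix_sum0 R d_gt0 2) => b <-.
by rewrite /p1 /p2; ring.
Qed.

Lemma prefix_sum1_3 : Oinv 4 (fun b => prefix_sum b d R 1 3 -
  (m2 * b%:R^-1 ^+ 2 + m3 * b%:R^-1 ^+ 3)).
Proof.
have W : Oinv 1 (fun b => ratio R b ^+ 3 - 1).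
  apply: (@ratio_pow_approx 3 1 (fun=> 1) (Poly [:: -3; -3; -1])) => y.
  by rewrite horner_Poly/=; ring.
have H := OinvB (OinvD lead_sum3_approx unit_sum3_approx)
  (OinvZ (2 * e ^+ 3) (OinvM (Oinv_exp R 3) W)).
apply: Oinv_near H; apply: filterS2 (near_prefix_sum1 R d_gt0 3)
  (near_double_digit_pow R d_gt0 3) => b <- <-.
by rewrite /m2 /m3 -/x -/e; ring.
Qed.

Lemma prefix_sum1_4 : Oinv 4 (fun b => prefix_sum b d R 1 4 - r3 * b%:R^-1 ^+ 3).
Proof.
have H := OinvB (OinvD lead_sum4_approx (@Oinv_unit_sum R d 4 isT))
  (OinvZ 2 (Oinv_double_digit_pow R d_gt0 4)).
apply: Oinv_near H; apply: filterS (near_prefix_sum1 R d_gt0 4) => b <-.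
by rewrite /r3; ring.
Qed.

(* The coefficients of the expansion of log_part. *)
Let l1 : R := e * (1 + e / 2).
Let l2 : R := - (e * (1 + 2 * (e / 2) + e ^+ 2 / 3)).
Let l3 : R := e * (1 + 3 * (e / 2) + 3 * (e ^+ 2 / 3) + e ^+ 3 / 4).
Let l4 : R := - (e * (1 + 4 * (e / 2) + 6 * (e ^+ 2 / 3) + 4 * (e ^+ 3 / 4) + e ^+ 4 / 5)).
Let l5 : R := e * (1 + 5 * (e / 2) + 10 * (e ^+ 2 / 3) + 10 * (e ^+ 3 / 4)
  + 5 * (e ^+ 4 / 5) + e ^+ 5 / 6).

Lemma log_part_approx : Oinv 6 (fun b => log_part R d 8 b -
  (l1 * b%:R^-1 + l2 * b%:R^-1 ^+ 2 + l3 * b%:R^-1 ^+ 3 + l4 * b%:R^-1 ^+ 4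
   + l5 * b%:R^-1 ^+ 5)).
Proof.
(* truncations at total degree 5 of y^j (1 + y)^-(j+1), divided by y^j *)
pose p j (y : R) : R := (nth (fun=> 0) [::
  (fun y => 1 - y + y ^+ 2 - y ^+ 3 + y ^+ 4 - y ^+ 5);
  (fun y => 1 - 2 * y + 3 * y ^+ 2 - 4 * y ^+ 3 + 5 * y ^+ 4);
  (fun y => 1 - 3 * y + 6 * y ^+ 2 - 10 * y ^+ 3);
  (fun y => 1 - 4 * y + 10 * y ^+ 2);
  (fun y => 1 - 5 * y);
  (fun=> 1)] j) y.
have W j : Oinv (6 - j) (fun b => ratio R b ^+ j.+1 - p j b%:R^-1).
  case: j => [|[|[|[|[|[|j]]]]]].
  - apply: (@ratio_pow_approx _ _ (p 0%N) (Poly [:: 1])) => y.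
    by rewrite horner_Poly /p/=; ring.
  - apply: (@ratio_pow_approx _ _ (p 1%N) (Poly [:: -6; -5])) => y.
    by rewrite horner_Poly /p/=; ring.
  - apply: (@ratio_pow_approx _ _ (p 2%N) (Poly [:: 15; 24; 10])) => y.
    by rewrite horner_Poly /p/=; ring.
  - apply: (@ratio_pow_approx _ _ (p 3%N) (Poly [:: -20; -45; -36; -10])) => y.
    by rewrite horner_Poly /p/=; ring.
  - apply: (@ratio_pow_approx _ _ (p 4%N) (Poly [:: 15; 40; 45; 24; 5])) => y.
    by rewrite horner_Poly /p/=; ring.
  - apply: (@ratio_pow_approx _ _ (p 5%N) (Poly [:: -6; -15; -20; -15; -6; -1])) => y.
    by rewrite horner_Poly /p/=; ring.
  - rewrite (_ : 6 - _ = 0)%N//; apply: (@Oinv_ext _ _ (fun b => ratio R b ^+ j.+1.+2.+4)).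
      by move=> b; rewrite /p/= nth_nil subr0.
    by rewrite -(muln0 j.+1.+2.+4); apply: OinvX; exact: Oinv_ratio.
have H : Oinv 6 (fun b => - \sum_(j < 8) (-1) ^+ j / j.+1%:R * e ^+ j.+1 *
    (b%:R^-1 ^+ j * (ratio R b ^+ j.+1 - p j b%:R^-1))).
  apply: OinvN; apply: Oinv_sum => j _; apply: OinvZ.
  by apply: OinvM_le (Oinv_exp R j) (W j); lia.
apply: Oinv_near H; apply: filterS (near_log_part R d_gt0 8) => b <-.
rewrite -/x -/e !big_ord_recl !big_ord0 /p/= /bump/=.
rewrite /l1 /l2 /l3 /l4 /l5; move: (e) (ratio R b) (b%:R^-1) => u r y.
by field.
Qed.

Local Arguments binomial : simpl never.

Lemma Oinv_damp1 m : (0 < m)%N -> Oinv m (fun b => damp R m b - 1).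
Proof.
move=> m0; have H := OinvMl (Oinv_damp R m0) (Oinv_damp_exponent R m0).
apply: Oinv_near H; exists 2%N => // b b1; rewrite /damp.
have dn := @damp_neq0 R m b m0 b1.
by apply: (mulfI dn); rewrite mulVKf// mulrBr mulfV//; ring.
Qed.

Lemma damp1_approx : Oinv 4 (fun b => damp R 1 b - (1 + b%:R^-1 - b%:R^-1 ^+ 3)).
Proof.
have H := OinvM (Oinv_exp R 4) (OinvMl (Oinv_horner (Poly [:: -1; 1]))
  (Oinv_damp R (isT : (0 < 1)%N))).
apply: Oinv_near H; exists 2%N => // b b1; rewrite /damp.
have dn := @damp_neq0 R 1 b isT b1.
apply: (mulfI dn); rewrite mulrBr mulfV// !(mulrCA (1 - _)) mulfV//.
by rewrite horner_Poly/=; ring.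
Qed.

Lemma near_dev01 : \forall b \near \oo,
  - h * (b%:R^-1 * damp R 1 b) = dev R d 0 1 b.
Proof.
apply: filterS2 (near_dev0_rec R d_gt0 (isT : (0 < 1)%N)) (dev_mass R d_gt0 0) => b <- E0.
rewrite !big_ord_recl !big_ord0 E0 /= /bump /= !(add1n, addn0, subSS, subn0) bin0 binn -/x.
by rewrite /h; move: (b%:R^-1) => y; field.
Qed.

Lemma dev01_approx : Oinv 5 (fun b => dev R d 0 1 b -
  - h * (b%:R^-1 + b%:R^-1 ^+ 2 - b%:R^-1 ^+ 4)).
Proof.
have H := OinvZ (- h) (OinvM (Oinv_inv R) damp1_approx).
by apply: Oinv_near H; apply: filterS near_dev01 => b <-; ring.
Qed.

Lemma dev01_approx3 : Oinv 3 (fun b => dev R d 0 1 b - - h * (b%:R^-1 + b%:R^-1 ^+ 2)).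
Proof.
have H := OinvD (Oinv_le (isT : (3 <= 5)%N) dev01_approx)
  (Oinv_monom h (isT : (3 <= 4)%N)).
by apply: Oinv_ext H => b; ring.
Qed.

Lemma near_dev11 : \forall b \near \oo,
  b%:R^-1 ^+ 2 * (damp R 1 b * dev R d 0 1 b) = dev R d 1 1 b.
Proof.
apply: filterS3 (near_dev_rec R d_gt0 1 (isT : (0 < 1)%N)) (dev_mass R d_gt0 0)
  (dev_mass R d_gt0 1) => b <- E0 E1.
rewrite !big_ord_recl !big_ord0 E0 E1 /= /bump /= !(add1n, addn0, subSS, subn0) bin0 binn.
by ring.
Qed.

Lemma dev11_approx : Oinv 5 (fun b => dev R d 1 1 b -
  - h * (b%:R^-1 ^+ 3 + 2 * b%:R^-1 ^+ 4)).
Proof.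
have D2 : Oinv 2 (fun b => damp R 1 b - (1 + b%:R^-1)).
  have H := OinvB (Oinv_le (isT : (2 <= 4)%N) damp1_approx)
    (Oinv_monom 1 (isT : (2 <= 3)%N)).
  by apply: Oinv_ext H => b; ring.
have g1 : Oinv 1 (fun b => - h * (b%:R^-1 + b%:R^-1 ^+ 2)).
  by apply: OinvZ; apply: OinvD; [exact: Oinv_inv | exact: Oinv_le (Oinv_exp R 2)].
have P := @OinvMB R 0 1 3 _ _ _ _ (Oinv_damp R (isT : (0 < 1)%N)) dev01_approx3 g1 D2.
have H := OinvD (OinvM (Oinv_exp R 2) P) (Oinv_monom (- h) (leqnn 5)).
by apply: Oinv_near H; apply: filterS near_dev11 => b <-; ring.
Qed.

(* minus the leading coefficient of alpha_2 *)
Let kappa : R := x ^+ 2 + 2 * x + 5 / 6.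

Lemma near_dev02 : \forall b \near \oo,
  damp R 2 b * (b%:R^-1 * (1 - b%:R^-1 - 2 * x * b%:R^-1 ^+ 2) * dev R d 0 1 b
    - b%:R^-1 ^+ 2 * (x ^+ 2 + x + 1 / 3)) = dev R d 0 2 b.
Proof.
apply: filterS3 (near_dev0_rec R d_gt0 (isT : (0 < 2)%N)) (dev_mass R d_gt0 0)
  (near_digit d_gt0) => b <- E0 [/ltnW b0 _].
rewrite !big_ord_recl !big_ord0 E0 /= /bump /= !(add1n, addn0, subSS, subn0) bin0 binn bin1 /sigma power_sum1// -/x.
by move: (b%:R^-1) (dev R d 0 1 b) (damp R 2 b) => y u v; field.
Qed.

Lemma dev02_approx : Oinv 4 (fun b => dev R d 0 2 b - - kappa * b%:R^-1 ^+ 2).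
Proof.
have s0 : Oinv 0 (fun b => 1 - b%:R^-1 - 2 * x * b%:R^-1 ^+ 2).
  apply: Oinv_ext (Oinv_horner (Poly [:: 1; -1; - (2 * x)])) => b.
  by rewrite horner_Poly/=; ring.
have A := OinvM (Oinv_inv R) (OinvMl s0 dev01_approx3).
have B := OinvM (Oinv_exp R 4) (Oinv_horner (Poly [:: h * (1 + 2 * x); 2 * x * h])).
have I := OinvMl (Oinv_damp R (isT : (0 < 2)%N)) (OinvD A B).
have J := OinvZ kappa (OinvM (Oinv_exp R 2) (Oinv_damp1 (isT : (0 < 2)%N))).
have H := OinvB I J.
apply: Oinv_near H; apply: filterS near_dev02 => b <-.
rewrite horner_Poly/= /kappa /h.
by move: (b%:R^-1) (dev R d 0 1 b) (damp R 2 b) => y u v; field.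
Qed.

Lemma near_dev03 : \forall b \near \oo,
  damp R 3 b * (b%:R^-1 * (1 + b%:R^-1 * (b%:R^-1 / 2 - 3 / 2 - 3 * b%:R^-1 ^+ 2 * x ^+ 2))
      * dev R d 0 1 b
    + b%:R^-1 ^+ 2 * (3 * sigma R d 1 b * dev R d 0 2 b)
    - b%:R^-1 ^+ 3 * (x ^+ 3 + 3 / 2 * x ^+ 2 + x + 1 / 4)) = dev R d 0 3 b.
Proof.
apply: filterS3 (near_dev0_rec R d_gt0 (isT : (0 < 3)%N)) (dev_mass R d_gt0 0)
  (near_digit d_gt0) => b <- E0 [/ltnW b0 _].
rewrite !big_ord_recl !big_ord0 E0 /= /bump /= !(add1n, addn0, subSS, subn0) bin0 binn bin1 (_ : 'C(3, 2) = 3%N)//.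
rewrite [sigma R d 2 b]/sigma power_sum2// -/x.
by move: (b%:R^-1) (dev R d 0 1 b) (damp R 3 b) => y u v; field.
Qed.

Lemma dev03_approx : Oinv 3 (fun b => dev R d 0 3 b - - h * b%:R^-1 ^+ 2).
Proof.
have D1 : Oinv 2 (fun b => dev R d 0 1 b - - h * b%:R^-1).
  have H := OinvD (Oinv_le (isT : (2 <= 3)%N) dev01_approx3) (Oinv_monom (- h) (leqnn 2)).
  by apply: Oinv_ext H => b; ring.
have s0 := Oinv_horner (Poly [:: 1; - (3 / 2); 1 / 2; - (3 * x ^+ 2)]).
have A := OinvM (Oinv_inv R) (OinvMl s0 D1).
have B := OinvM (Oinv_exp R 3)
  (Oinv_horner (Poly [:: h * (3 / 2); - (h / 2); h * (3 * x ^+ 2)])).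
have C := OinvM_le (isT : (3 <= 2 + 1)%N) (Oinv_exp R 2)
  (OinvZ 3 (OinvMl (Oinv_sigma R d 1) (Oinv_dev0 R d_gt0 2))).
have K := OinvM (Oinv_exp R 3) (Oinv_cst (x ^+ 3 + 3 / 2 * x ^+ 2 + x + 1 / 4)).
have I := OinvMl (Oinv_damp R (isT : (0 < 3)%N)) (OinvB (OinvD (OinvD A B) C) K).
have J := OinvM_le (isT : (3 <= 2 + 3)%N) (OinvZ h (Oinv_exp R 2))
  (Oinv_damp1 (isT : (0 < 3)%N)).
have H := OinvB I J.
apply: Oinv_near H; apply: filterS near_dev03 => b <-.
rewrite !horner_Poly/=.
by move: (b%:R^-1) (dev R d 0 1 b) (damp R 3 b) => y u v; field.
Qed.

(** All other terms of the sum are O(y^6), by the orders of the deviations. *)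
Lemma dev_part_approx : Oinv 6 (fun b => dev_part R d 8 b -
  (- (dev R d 1 1 b * prefix_sum b d R 0 2 + dev R d 0 1 b * prefix_sum b d R 1 2)
   + dev R d 0 2 b * prefix_sum b d R 1 3 - dev R d 0 3 b * prefix_sum b d R 1 4)).
Proof.
pose g j b : R := (-1) ^+ j * (dev R d 1 j b * prefix_sum b d R 0 j.+1 +
                            dev R d 0 j b * prefix_sum b d R 1 j.+1).
have g0 : Oinv 6 (g 0%N).
  apply: OinvZ; apply: Oinv_near (Oinv0 R 6).
  apply: filterS2 (dev_mass R d_gt0 0) (dev_mass R d_gt0 1) => b -> ->.
  by rewrite !mul0r addr0.
have dev1P j : (1 < j)%N -> Oinv 6 (fun b => dev R d 1 j b * prefix_sum b d R 0 j.+1).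
  move=> j1; apply: OinvM_le (Oinv_dev1_high R d_gt0 _) (Oinv_prefix_sum0 R d_gt0 _);
    [lia | by case: j j1 => [|[]] | exact: ltnW].
have gj j : (3 < j)%N -> Oinv 6 (g j).
  move=> j3; apply: OinvZ; apply: OinvD; first by apply: dev1P; lia.
  apply: OinvM_le (Oinv_dev0_high R d_gt0 _) (Oinv_prefix_sum1 R d_gt0 _);
    [lia | by case: j j3 => [|[]] | by case: j j3].
have H := OinvD (OinvD (OinvB (dev1P 2%N isT) (dev1P 3%N isT)) g0)
  (OinvD (OinvD (gj 4%N isT) (gj 5%N isT)) (OinvD (gj 6%N isT) (gj 7%N isT))).
apply: Oinv_ext H => b; rewrite /dev_part !big_ord_recl big_ord0 /bump/= /g.
by ring.
Qed.

Lemma dev_part_approx_poly : Oinv 6 (fun b => dev_part R d 8 b -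
  (h * n1 * b%:R^-1 ^+ 2 + h * (n1 + n2) * b%:R^-1 ^+ 3
   + (h * (n2 + n3) + h * p1 - kappa * m2) * b%:R^-1 ^+ 4
   + (h * (n3 + n4 - n1) + h * (p2 + 2 * p1) - kappa * m3 + h * r3) * b%:R^-1 ^+ 5)).
Proof.
apply: (OinvB_trans dev_part_approx).
have P1 : Oinv 1 (fun b => p1 * b%:R^-1 + p2 * b%:R^-1 ^+ 2).
  apply: OinvD; last exact: Oinv_monom.
  by apply: OinvZ; exact: Oinv_inv.
have N1 : Oinv 1 (fun b => n1 * b%:R^-1 + n2 * b%:R^-1 ^+ 2 + n3 * b%:R^-1 ^+ 3
    + n4 * b%:R^-1 ^+ 4).
  apply: OinvD; last exact: Oinv_monom.
  apply: OinvD; last exact: Oinv_monom.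
  apply: OinvD; last exact: Oinv_monom.
  by apply: OinvZ; exact: Oinv_inv.
have M2 : Oinv 2 (fun b => m2 * b%:R^-1 ^+ 2 + m3 * b%:R^-1 ^+ 3).
  by apply: OinvD; exact: Oinv_monom.
have R3 := Oinv_monom r3 (leqnn 3).
have A := @OinvMB R 3 1 6 _ _ _ _ (Oinv_dev1 R d_gt0 1) prefix_sum0_2 P1 dev11_approx.
have B := @OinvMB R 1 1 6 _ _ _ _ (Oinv_dev0 R d_gt0 1) prefix_sum1_2 N1 dev01_approx.
have C := @OinvMB R 2 2 6 _ _ _ _ (@Oinv_dev0_high R d d_gt0 2 isT) prefix_sum1_3 M2 dev02_approx.
have D := @OinvMB R 2 3 6 _ _ _ _ (@Oinv_dev0_high R d d_gt0 3 isT) prefix_sum1_4 R3 dev03_approx.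
(* the terms of degree at least 6 of the product of the polynomials *)
have E := OinvM (Oinv_exp R 6) (Oinv_horner (Poly [:: h * (2 * p2 + n4 - n2);
   - h * n3; - h * n4])).
have H := OinvD (OinvB (OinvB C D) (OinvD A B)) E.
by apply: Oinv_ext H => b; rewrite horner_Poly/=; ring.
Qed.

Lemma irwin_approx6 : Oinv 6 (fun b => irwin R b d 1 - b%:R * ln b%:R -
  (irwin1_coef1 R d * b%:R^-1 + irwin1_coef2 R d * b%:R^-1 ^+ 2
   + irwin1_coef3 R d * b%:R^-1 ^+ 3 + irwin1_coef4 R d * b%:R^-1 ^+ 4
   + irwin1_coef5 R d * b%:R^-1 ^+ 5)).
Proof.
have x0 : 0 < x by rewrite ltr0n.
have xn : x != 0 by rewrite gt_eqF.
have x1n : x + 1 != 0 by rewrite gt_eqF// addr_gt0.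
have c1 : irwin1_coef1 R d = l1.
  by rewrite /irwin1_coef1 /l1 /e -/x; field.
have c2 : irwin1_coef2 R d = l2 + h * n1.
  by rewrite /irwin1_coef2 /l2 /h /n1 /e /f -/x; field; rewrite xn x1n.
have c3 : irwin1_coef3 R d = l3 + h * (n1 + n2).
  by rewrite /irwin1_coef3 /l3 /h /n1 /n2 /e /f -/x; field; rewrite xn x1n.
have c4 : irwin1_coef4 R d = l4 + (h * (n2 + n3) + h * p1 - kappa * m2).
  by rewrite /irwin1_coef4 /l4 /h /n2 /n3 /p1 /m2 /kappa /e /f -/x; field; rewrite xn x1n.
have c5 : irwin1_coef5 R d = l5 +
    (h * (n3 + n4 - n1) + h * (p2 + 2 * p1) - kappa * m3 + h * r3).
  rewrite /irwin1_coef5 /l5 /h /n1 /n3 /n4 /p1 /p2 /m3 /r3 /kappa /e /f -/x.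
  by field; rewrite xn x1n.
have H := OinvD (irwin_decomposition R d_gt0 6) (OinvD log_part_approx dev_part_approx_poly).
by apply: Oinv_ext H => b; rewrite c1 c2 c3 c4 c5; ring.
Qed.

End Coefficients.

Theorem proposition12 (R : realType) (d : nat) (d_gt0 : (0 < d)%N) :
  (exists a : nat -> R,
    has_asymptotic_expansion
      (fun b : nat => irwin R b d 1 - b%:R * ln (b%:R : R)) a /\
    a 0%N = 0 /\ a 1%N = irwin1_coef1 R d /\ a 2%N = irwin1_coef2 R d /\
    a 3%N = irwin1_coef3 R d /\ a 4%N = irwin1_coef4 R d /\ a 5%N = irwin1_coef5 R d) /\
  (fun b : nat => irwin R b d 1
     - (b%:R * ln (b%:R : R) + irwin1_coef1 R d / b%:R + irwin1_coef2 R d / b%:R ^+ 2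
        + irwin1_coef3 R d / b%:R ^+ 3 + irwin1_coef4 R d / b%:R ^+ 4
        + irwin1_coef5 R d / b%:R ^+ 5))
    =O_\oo (fun b : nat => b%:R ^- 6 : R).
Proof.
have approx6 := irwin_approx6 R d_gt0; split; last first.
  by apply: OinvP; apply: Oinv_ext approx6 => b; rewrite !exprVn; ring.
pose s := [:: 0; irwin1_coef1 R d; irwin1_coef2 R d; irwin1_coef3 R d;
  irwin1_coef4 R d; irwin1_coef5 R d].
have [||a aE a_coef] := @expandable_has_expansion R 6
    (fun b => irwin R b d 1 - b%:R * ln b%:R) (Poly s).
- exact: expandable_irwin.
- by apply: Oinv_ext approx6 => b; rewrite horner_Poly/=; ring.
by exists a; split; rewrite // !a_coef// !coef_Poly.
Qed.
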